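(* Let $A$ be a positively graded Noetherian $k$-algebra, let $e$ be a primitive idempotent of $A$ of degree zero, let $\Gamma=(1-e)A(1-e)$ and $S_e=eA/e\,\mathrm{rad}A$. Assume that $\mathrm{Ext}^1_A(S_e,S_e)=0$. If $\mathrm{pd}_A S_e$ and $\mathrm{pd}_\Gamma F(eA)$ are finite, where $F(eA)=\mathrm{Hom}_A((1-e)A,eA)\cong eA(1-e)$ as a right $\Gamma$-module, then $S_e$ is self-orthogonal, that is, $\mathrm{Ext}^i_A(S_e,S_e)=0$ for all $i>0$.
   Context: $k$ is an algebraically closed field. Algebras are associative and unital; Noetherian means left and right Noetherian. Positively graded means: $A=\bigoplus_{i\ge 0}A_i$ as vector spaces, where $A_0$ is a product of finitely many copies of $k$ and $A_iA_j=A_{i+j}$ for all $i,j\ge 0$. $\mathrm{rad}A$ denotes the graded Jacobson radical $\bigoplus_{i\ge1}A_i$. Of degree zero means lying in $A_0$. Modules are right modules; $\mathrm{Ext}$ and the projective dimension $\mathrm{pd}$ are taken in the category of (ungraded) modules. *)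

(* Defs.v *)
From HB Require Import structures.
From mathcomp Require Import all_boot all_algebra.
From mathcomp Require Import generic_quotient ring_quotient.
From mathcomp Require Import boolp functions.

Set Implicit Arguments.
Unset Strict Implicit.
Unset Printing Implicit Defensive.

Import GRing.Theory.

Local Open Scope ring_scope.

(* A right R-module is a left module over the converse ring R^c: the right
   action x.a is (a : R^c) *: x.  In particular (R^c)^o is R as a right module
   over itself, since there a *: x = x * a. *)
Notation rmodType R := (lmodType R^c).

Section Submodule.
Variables (R : pzRingType) (M : lmodType R) (N : submodClosed M).

Record submod : Type := Submod { submod_val : M; _ : submod_val \in N }.

HB.instance Definition _ := [isSub for submod_val].
HB.instance Definition _ := [Choice of submod by <:].
HB.instance Definition _ := [SubChoice_isSubLmodule of submod by <:].

End Submodule.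

Section QuotientModule.
Variables (R : pzRingType) (M : lmodType R) (N : submodClosed M).

(* A submodClosed predicate does not come with closure under opposites, which
   the additive quotients of ring_quotient require. *)
Definition submod_zmod : {pred M} := N.

Fact submod_zmod_closed : zmod_closed submod_zmod.
Proof.
split=> [|x y xN yN]; first exact: (rpred0 N).
by rewrite -[_ \in _]/(_ \in N) -scaleN1r rpredD // rpredZ.
Qed.

HB.instance Definition _ := GRing.isZmodClosed.Build M submod_zmod
  submod_zmod_closed.

Definition quotmod : Type := Quotient.quot submod_zmod.

HB.instance Definition _ := GRing.Zmodule.on quotmod.

Definition quotmod_pi (x : M) : quotmod := \pi_(Quotient.quot submod_zmod)%qT x.

Definition quotmod_repr (x : quotmod) : M := repr (x : (Quotient.quot submod_zmod)).

Definition quotmod_scale (a : R) (x : quotmod) : quotmod :=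
  quotmod_pi (a *: quotmod_repr x).

Fact quotmod_piP x y : (quotmod_pi x = quotmod_pi y) <-> (x - y \in N).
Proof.
rewrite -[x - y \in N]/(x - y \in submod_zmod) Quotient.idealrBE.
by split=> [/eqP|/eqP].
Qed.

Fact quotmod_reprK : cancel quotmod_repr quotmod_pi.
Proof. exact: reprK. Qed.

Fact quotmod_piD x y : quotmod_pi (x + y) = quotmod_pi x + quotmod_pi y.
Proof. exact: Quotient.pi_add. Qed.

Fact quotmod_scale_pi a x :
  quotmod_scale a (quotmod_pi x) = quotmod_pi (a *: x).
Proof.
apply/quotmod_piP; rewrite -scalerBr; apply: rpredZ.
by apply/quotmod_piP; rewrite quotmod_reprK.
Qed.

Fact quotmod_scalerA a b x :
  quotmod_scale a (quotmod_scale b x) = quotmod_scale (a * b) x.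
Proof. by rewrite quotmod_scale_pi scalerA. Qed.

Fact quotmod_scale1r : left_id 1 quotmod_scale.
Proof. by move=> x; rewrite /quotmod_scale scale1r quotmod_reprK. Qed.

Fact quotmod_scalerDr : right_distributive quotmod_scale +%R.
Proof.
move=> a x y; rewrite -[x]quotmod_reprK -[y]quotmod_reprK -quotmod_piD.
by rewrite !quotmod_scale_pi scalerDr quotmod_piD.
Qed.

Fact quotmod_scalerDl x : {morph quotmod_scale^~ x : a b / a + b}.
Proof. by move=> a b; rewrite /quotmod_scale scalerDl quotmod_piD. Qed.

HB.instance Definition _ := GRing.Zmodule_isLmodule.Build R quotmod
  quotmod_scalerA quotmod_scale1r quotmod_scalerDr quotmod_scalerDl.

Fact quotmod_pi_is_linear : linear quotmod_pi.
Proof. by move=> a x y; rewrite quotmod_piD -quotmod_scale_pi. Qed.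

HB.instance Definition _ := GRing.isLinear.Build R M quotmod *:%R quotmod_pi
  quotmod_pi_is_linear.

End QuotientModule.

Section ModuleHom.
Variables (R : pzRingType) (U V : lmodType R).

Definition linear_pred : {pred U -> V} := fun f => `[< linear f >].

Fact linear_pred_zmod_closed : zmod_closed linear_pred.
Proof.
split=> [|f g /asboolP lf /asboolP lg]; apply/asboolP => a x y.
  by rewrite scaler0 addr0.
have subE z : (f - g) z = f z - g z by [].
by rewrite !subE lf lg scalerBr opprD addrACA.
Qed.

HB.instance Definition _ := GRing.isZmodClosed.Build (U -> V) linear_pred
  linear_pred_zmod_closed.

Record modHom : Type := ModHom { modHom_val :> U -> V;
                                 _ : modHom_val \in linear_pred }.

HB.instance Definition _ := [isSub for modHom_val].
HB.instance Definition _ := [Choice of modHom by <:].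
HB.instance Definition _ := [SubChoice_isSubZmodule of modHom by <:].

Fact modHomP (f : modHom) : linear f.
Proof. by case: f => f lf; apply/asboolP. Qed.

Fact modHom_ext (f g : modHom) : (forall x, f x = g x) -> f = g.
Proof. by move=> fg; apply/val_inj/funext. Qed.

Fact modHom_addE (f g : modHom) x : (f + g) x = f x + g x.
Proof. by []. Qed.

End ModuleHom.

Section Homological.
Variable R : pzRingType.

Definition projective (P : lmodType R) : Prop :=
  forall (M N : lmodType R) (g : {linear M -> N}) (f : {linear P -> N}),
    (forall y, exists x, g x = y) ->
  exists h : {linear P -> M}, forall p, g (h p) = f p.

(* ... -> P 2 -> P 1 -> P 0 -> M -> 0, with d n : P (n + 1) -> P n *)
Record projective_resolution (M : lmodType R) := ProjectiveResolution {
  res_obj :> nat -> lmodType R;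
  res_d : forall n, {linear res_obj n.+1 -> res_obj n};
  res_aug : {linear res_obj 0%N -> M};
  res_projective : forall n, projective (res_obj n);
  res_aug_surj : forall x, exists p, res_aug p = x;
  res_exact0 : forall p, res_aug p = 0 <-> exists q, res_d 0%N q = p;
  res_exact : forall n p, res_d n p = 0 <-> exists q, res_d n.+1 q = p
}.

Definition finite_pd (M : lmodType R) : Prop :=
  exists (P : projective_resolution M) (n : nat),
    forall i, (n < i)%N -> forall p : P i, p = 0.

Section Cohomology.
Variables (M : lmodType R) (P : projective_resolution M) (N : lmodType R).

Definition cocycle n (f : {linear P n -> N}) : Prop :=
  forall q, f (res_d P n q) = 0.

Definition coboundary n : {linear P n -> N} -> Prop :=
  match n with
  | 0 => fun f => forall p, f p = 0
  | m.+1 => fun f => exists g : {linear P m -> N},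
                       forall p, f p = g (res_d P m p)
  end.

End Cohomology.

(* Ext^n_R(M, N) = 0, where Ext^n_R(M, N) is the n-th cohomology group of
   Hom_R(P, N) for P a projective resolution of M.  This group does not depend
   on P up to isomorphism, so its vanishing is required for every P. *)
Definition Ext_eq0 n (M N : lmodType R) : Prop :=
  forall (P : projective_resolution M) (f : {linear P n -> N}),
    cocycle f -> coboundary f.

Definition noetherian_module (M : lmodType R) : Prop :=
  forall N : nat -> submodClosed M,
    (forall n, {subset N n <= N n.+1}) ->
  exists n, forall m, (n <= m)%N -> N m =i N n.

End Homological.

Definition noetherian_ring (R : pzRingType) : Prop :=
  noetherian_module (R^o : lmodType R) /\
  noetherian_module ((R^c)^o : rmodType R).

Record positive_grading (k : fieldType) (A : algType k) := PositiveGrading {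
  gr :> nat -> submodClosed A;
  gr_span : forall a : A, exists (n : nat) (u : nat -> A),
    (forall i, u i \in gr i) /\ a = \sum_(i < n) u i;
  gr_direct : forall (n : nat) (u : nat -> A),
    (forall i, u i \in gr i) -> \sum_(i < n) u i = 0 ->
    forall i, (i < n)%N -> u i = 0;
  gr_zero : exists (n : nat) (phi : {linear {ffun 'I_n -> k^o} -> A}),
    [/\ monoid_morphism phi, injective phi
      & forall a, a \in gr 0%N <-> exists c, phi c = a];
  (* A_i A_j is the span of the products, as usual *)
  gr_mul : forall i j a, a \in gr (i + j)%N <->
    exists (n : nat) (u v : 'I_n -> A),
      [/\ forall l, u l \in gr i, forall l, v l \in gr j
        & a = \sum_l u l * v l]
}.

(* rad A is the graded radical: the sum of the A_i with i >= 1. *)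
Definition in_rad (k : fieldType) (A : algType k) (G : positive_grading A)
    (a : A) : Prop :=
  exists (n : nat) (u : nat -> A),
    (forall i, u i \in G i.+1) /\ a = \sum_(i < n) u i.

Record primitive_idempotent (R : pzRingType) (e : R) : Prop := {
  primitive_idem : e * e = e;
  primitive_neq0 : e <> 0;
  primitive_indec : forall f g : R,
    f * f = f -> g * g = g -> f * g = 0 -> g * f = 0 ->
    e = f + g -> f = 0 \/ g = 0
}.

Section RightIdeal.
Variables (R : pzRingType) (e : R).

Definition eR_pred : {pred (R^c)^o} := fun x => `[< exists a : R, x = e * a :> R >].

Fact eR_submod_closed : submod_closed eR_pred.
Proof.
split=> [|r x y /asboolP[a ->] /asboolP[b ->]]; apply/asboolP.
  by exists 0; rewrite mulr0.
by exists (a * r + b); rewrite mulrDr mulrA.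
Qed.

HB.instance Definition _ := GRing.isSubmodClosed.Build R^c (R^c)^o eR_pred
  eR_submod_closed.

Definition eR : rmodType R := submod eR_pred.

End RightIdeal.

Section Top.
Variables (k : fieldType) (A : algType k) (G : positive_grading A).

Fact in_radD a b : in_rad G a -> in_rad G b -> in_rad G (a + b).
Proof.
move=> [n [u [uG ->]]] [m [v [vG ->]]].
pose cut p (w : nat -> A) i := if (i < p)%N then w i else 0.
have cutG p w : (forall i, w i \in G i.+1) -> forall i, cut p w i \in G i.+1.
  by move=> wG i; rewrite /cut; case: ifP => // _; exact: rpred0.
have cutE p q (w : nat -> A) : (p <= q)%N -> \sum_(i < p) w i = \sum_(i < q) cut p w i.
  by move=> pq; rewrite (big_ord_widen q w pq) big_mkcond.
exists (maxn n m), (fun i => cut n u i + cut m v i); split=> [i|].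
  by apply: rpredD; apply: cutG.
by rewrite big_split /= -!cutE ?leq_maxl ?leq_maxr.
Qed.

Fact in_rad0 : in_rad G 0.
Proof. by exists 0%N, (fun=> 0); split=> [i|]; rewrite ?rpred0 ?big_ord0. Qed.

Fact in_rad_sum n (u : 'I_n -> A) :
  (forall i, in_rad G (u i)) -> in_rad G (\sum_i u i).
Proof.
by move=> uG; apply: (big_ind (in_rad G)) => //; [exact: in_rad0|exact: in_radD].
Qed.

Fact in_rad_homog i a : a \in G i.+1 -> in_rad G a.
Proof.
move=> aG; exists i.+1, (fun j => if j == i then a else 0); split=> [j|].
  by case: eqP => [->|_] //; exact: rpred0.
rewrite (bigD1 ord_max) //= eqxx big1 ?addr0 // => j.
by rewrite -val_eqE /= => /negbTE ->.
Qed.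

Fact in_radMr a r : in_rad G a -> in_rad G (a * r).
Proof.
move=> [n [u [uG ->]]]; have [m [v [vG ->]]] := gr_span G r.
rewrite mulr_suml; apply: in_rad_sum => i; rewrite mulr_sumr.
apply: in_rad_sum => j; apply: (@in_rad_homog (i + j)); rewrite -addSn.
by apply/gr_mul; exists 1%N, (fun=> u i), (fun=> v j); rewrite big_ord1.
Qed.

Variable e : A.

Definition eRad_pred : {pred eR e} :=
  fun x => `[< exists r : A, in_rad G r /\ submod_val x = e * r :> A >].

Fact eRad_submod_closed : submod_closed eRad_pred.
Proof.
split=> [|a x y /asboolP[r [rG xE]] /asboolP[s [sG yE]]]; apply/asboolP.
  by exists 0; split; [exact: in_rad0|rewrite mulr0].
exists (r * a + s); split; first by apply: in_radD => //; apply: in_radMr.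
rewrite mulrDr mulrA -xE -yE; reflexivity.
Qed.

HB.instance Definition _ := GRing.isSubmodClosed.Build A^c (eR e) eRad_pred
  eRad_submod_closed.

Definition topS : rmodType A := quotmod eRad_pred.

End Top.

Section Corner.
Variables (R : pzRingType) (f : R).

Definition corner_pred : {pred R} := fun x => `[< exists a, x = f * a * f >].

Fact corner_zmod_closed : zmod_closed corner_pred.
Proof.
split=> [|x y /asboolP[a ->] /asboolP[b ->]]; apply/asboolP.
  by exists 0; rewrite mulr0 mul0r.
by exists (a - b); rewrite mulrBr mulrBl.
Qed.

HB.instance Definition _ := GRing.isZmodClosed.Build R corner_pred
  corner_zmod_closed.

(* The ring fRf with unit f, for an idempotent f; the proof of idempotence is
   kept as a parameter of the type because the ring structure needs it. *)
Record corner (ff : f * f = f) : Type := Corner {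
  corner_val : R;
  corner_valP : corner_val \in corner_pred
}.

Variable ff : f * f = f.

HB.instance Definition _ := [isSub for (@corner_val ff)].
HB.instance Definition _ := [Choice of corner ff by <:].
HB.instance Definition _ := [SubChoice_isSubZmodule of corner ff by <:].

Fact corner_idl x : x \in corner_pred -> f * x = x.
Proof. by move=> /asboolP[a ->]; rewrite !mulrA ff. Qed.

Fact corner_idr x : x \in corner_pred -> x * f = x.
Proof. by move=> /asboolP[a ->]; rewrite -!mulrA ff. Qed.

Fact corner_one_subproof : f \in corner_pred.
Proof. by apply/asboolP; exists 1; rewrite mulr1 ff. Qed.

Fact corner_mul_subproof x y :
  x \in corner_pred -> y \in corner_pred -> x * y \in corner_pred.
Proof.
move=> xP yP; apply/asboolP; exists (x * y).
by rewrite mulrA corner_idl // -mulrA corner_idr.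
Qed.

Definition corner_one : corner ff := Corner ff corner_one_subproof.

Definition corner_mul (x y : corner ff) : corner ff :=
  Corner ff (corner_mul_subproof (corner_valP x) (corner_valP y)).

Fact corner_mulA : associative corner_mul.
Proof. by move=> x y z; apply/val_inj; rewrite /= mulrA. Qed.

Fact corner_mul1l : left_id corner_one corner_mul.
Proof. by move=> x; apply/val_inj; rewrite /= corner_idl ?corner_valP. Qed.

Fact corner_mul1r : right_id corner_one corner_mul.
Proof. by move=> x; apply/val_inj; rewrite /= corner_idr ?corner_valP. Qed.

Fact corner_mulDl : left_distributive corner_mul +%R.
Proof. by move=> x y z; apply/val_inj; rewrite /= mulrDl. Qed.

Fact corner_mulDr : right_distributive corner_mul +%R.
Proof. by move=> x y z; apply/val_inj; rewrite /= mulrDr. Qed.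

HB.instance Definition _ := GRing.Zmodule_isPzRing.Build (corner ff)
  corner_mulA corner_mul1l corner_mul1r corner_mulDl corner_mulDr.

Fact corner_act_subproof (g : corner ff) (x : eR f) :
  corner_val g * submod_val x \in eR_pred f.
Proof.
apply/asboolP; exists (corner_val g * submod_val x).
by rewrite mulrA corner_idl ?corner_valP.
Qed.

Definition corner_act (g : corner ff) (x : eR f) : eR f :=
  @Submod _ _ (eR_pred f : submodClosed _) _ (corner_act_subproof g x).

Fact corner_act_linear g : linear (corner_act g).
Proof.
move=> a x y; apply/val_inj; rewrite /= mulrDr; congr (_ + _).
exact: (mulrA (corner_val g) (submod_val x) (a : R)).
Qed.

Variable M : rmodType R.

(* The functor Hom_R(fR, -) from right R-modules to right fRf-modules, where
   (phi.g)(x) = phi (g x). *)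
Definition cornerHom (_ : f * f = f) : Type := modHom (eR f) M.

Local Notation F := (cornerHom ff).

HB.instance Definition _ := GRing.Zmodule.on F.

Fact cornerHom_scale_subproof (g : (corner ff)^c) (phi : F) :
  (phi : modHom _ _) \o corner_act g \in @linear_pred R^c (eR f) M.
Proof. by apply/asboolP => a x y /=; rewrite corner_act_linear modHomP. Qed.

Definition cornerHom_scale (g : (corner ff)^c) (phi : F) : F :=
  ModHom (cornerHom_scale_subproof g phi).

Fact cornerHom_scalerA a b phi :
  cornerHom_scale a (cornerHom_scale b phi) = cornerHom_scale (a * b) phi.
Proof.
apply: modHom_ext => x /=; congr (phi _); apply/val_inj => /=.
by rewrite mulrA.
Qed.

Fact cornerHom_scale1r : left_id 1 cornerHom_scale.
Proof.
move=> phi; apply: modHom_ext => x /=; congr (phi _); apply/val_inj => /=.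
by case: x => x /= /asboolP[a ->]; rewrite mulrA ff.
Qed.

Fact cornerHom_scalerDr : right_distributive cornerHom_scale +%R.
Proof. by move=> a phi psi; apply: modHom_ext. Qed.

Fact cornerHom_scalerDl phi : {morph cornerHom_scale^~ phi : a b / a + b}.
Proof.
move=> a b; apply: modHom_ext => x /=.
rewrite -[LHS]/((phi : modHom _ _) (corner_act (a + b) x)).
have -> : corner_act (a + b) x = 1 *: corner_act a x + corner_act b x.
  by apply/val_inj; rewrite /= scale1r mulrDl.
by rewrite modHomP scale1r.
Qed.

HB.instance Definition _ := GRing.Zmodule_isLmodule.Build (corner ff)^c F
  cornerHom_scalerA cornerHom_scale1r cornerHom_scalerDr cornerHom_scalerDl.

End Corner.

Fact idem_compl (R : pzRingType) (e : R) :
  e * e = e -> (1 - e) * (1 - e) = 1 - e.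
Proof. by move=> ee; rewrite mulrBl mul1r mulrBr mulr1 ee subrr subr0. Qed.

(* Main.v *)
Require Import Defs.
From HB Require Import structures.
From mathcomp Require Import all_boot all_algebra.
From mathcomp Require Import boolp classical_sets functions.

Set Implicit Arguments.
Unset Strict Implicit.
Unset Printing Implicit Defensive.

Import GRing.Theory.
Local Open Scope ring_scope.

(** Let f = 1 - e, let Gamma = fAf, and write F = Hom(fA, -) and S = S_e.

    In derived terms the argument is as follows. Resolve F(eA) over Gamma and
    induce up to A; this gives a complex of modules in Add(fA) with a map to eA,
    whose cone C satisfies F(C) = 0. Its homology modules are killed by f.
    As Ext^1(S, S) = 0 gives e A_1 e = 0, the ring A / AfA is k, and these
    modules are direct sums of copies of S. Since Hom(fA, S) = 0, the complex
    RHom(C, S) is RHom(eA, S) = k in degree 0. If n > 0 is the last degree with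
    Ext^n(S, S) nonzero and d is the last degree with H_d(C) nonzero (H_0(C) = S
    is nonzero), then in the spectral sequence from Ext^p(H_q(C), S) to
    H^(p+q) RHom(C, S) the corner term Ext^n(H_d(C), S) survives. It lies in
    degree n + d > 0: a contradiction.

    The formal proof replaces complexes by dimension shifting. For a module M,
    the sum L of copies of fA indexed by Hom(fA, M) maps onto the trace MfA; let
    K be the kernel. Then 0 -> F(K) -> F(L) -> F(M) -> 0 is exact with F(L)
    projective, so pd F(K) < pd F(M) unless F(M) is projective; in the latter
    case KfA is a direct summand of L. The module M / MfA is killed by f.
    Assume that Ext^m(S, S) = 0 for m > n > 0 and Ext^n(S, S) is nonzero. Then
    for modules Q with Qf = 0 we have Ext^m(Q, S) = 0 for m > n, and
    Ext^n(Q, S) = 0 only if Q = 0. If Ext^m(M, S) = 0 for all m >= n, the same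
    follows for MfA and for K. By induction on pd F(M), Ext^m(KfA, S) = 0 for all
    m >= 0; hence Ext^n(K / KfA, S) = 0, so K = KfA, and then
    Ext^m(MfA, S) = 0 for all m >= 0 (trace_ext_vanishP). For M = eA this gives
    in the same way eA = eAfA and Hom(eA, S) = 0, which is absurd. So
    Ext^n(S, S) = 0 (top_ext_vanish_step), and descending induction on n from
    pd S concludes.

    That modules killed by f are direct summands of sums of copies of S rests on
    Zorn's lemma (simple_like_split), and so does the implication from
    Ext^1(S, S) = 0 to e A_1 e = 0 (ext1_no_loop). *)

(** * Linear maps and short exact sequences *)

Section LinearMaps.
Variable R : pzRingType.
Implicit Types U V W X Y Z : lmodType R.

(** A linear map from a linear function, locked so that simplification does
    not expose the underlying function. *)
Definition linear_map_of U V (f : U -> V) (lf : linear f) : {linear U -> V} :=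
  let lin : {linear U -> V} := HB.pack f (GRing.isLinear.Build R U V *:%R f lf) in
  locked lin.

Lemma linear_map_ofE U V (f : U -> V) (lf : linear f) :
  linear_map_of lf =1 f.
Proof. by rewrite /linear_map_of -lock. Qed.

Lemma subl_eq0 U V (f : {linear U -> V}) x y : f (x - y) = 0 <-> f x = f y.
Proof.
rewrite linearB; split=> [/eqP|->]; last by rewrite subrr.
by rewrite subr_eq0 => /eqP.
Qed.

(** A linear map that kills the kernel of a surjection factors through it. *)
Lemma factor_surj U V W (g : {linear U -> V}) (h : {linear U -> W}) :
  (forall y, exists x, g x = y) -> (forall x, g x = 0 -> h x = 0) ->
  exists h' : {linear V -> W}, forall x, h' (g x) = h x.
Proof.
move=> gsurj gh; have [s sE] := choice gsurj.
have hg x y : g x = g y -> h x = h y.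
  by move=> gxy; apply/subl_eq0/gh/subl_eq0.
have lf : linear (h \o s).
  move=> a x y /=; rewrite -linearP; apply: hg.
  by rewrite linearP !sE.
by exists (linear_map_of lf) => x; rewrite linear_map_ofE; apply: hg; rewrite sE.
Qed.

(** A linear map with image in that of an injection factors through it. *)
Lemma factor_inj U V W (i : {linear U -> V}) (h : {linear W -> V}) :
  (forall x, i x = 0 -> x = 0) -> (forall w, exists x, i x = h w) ->
  exists h' : {linear W -> U}, forall w, i (h' w) = h w.
Proof.
move=> iinj ih; have [s sE] := choice ih.
have lf : linear s.
  move=> a x y; apply/eqP; rewrite -subr_eq0; apply/eqP/iinj.
  by rewrite linearB linearP !sE linearP subrr.
by exists (linear_map_of lf) => w; rewrite linear_map_ofE sE.
Qed.

(** [ses i g]: the sequence 0 -> X -> Y -> Z -> 0 is exact. *)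
Record ses X Y Z (i : {linear X -> Y}) (g : {linear Y -> Z}) : Prop := Ses {
  ses_inj : forall x, i x = 0 -> x = 0;
  ses_surj : forall z, exists y, g y = z;
  ses_comp : forall x, g (i x) = 0;
  ses_exact : forall y, g y = 0 -> exists x, i x = y
}.

End LinearMaps.

Section SubQuotient.
Variables (R : pzRingType) (M : lmodType R) (W : M -> Prop).
Hypothesis Wc : W 0 /\ forall a x y, W x -> W y -> W (a *: x + y).

(** The submodule defined by a proposition closed under linear combinations. *)
Definition prop_pred of W 0 /\ (forall a x y, W x -> W y -> W (a *: x + y)) :
  {pred M} := fun x => `[< W x >].

Fact prop_pred_closed : submod_closed (prop_pred Wc).
Proof.
case: (Wc) => W0 WD; split=> [|a x y /asboolP Wx /asboolP Wy]; apply/asboolP.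
  exact: W0.
exact: WD.
Qed.

HB.instance Definition _ := GRing.isSubmodClosed.Build R M (prop_pred Wc)
  prop_pred_closed.

Lemma exists_submodule : exists (N : lmodType R) (i : {linear N -> M}),
  (forall x, i x = 0 -> x = 0) /\ (forall y, W y <-> exists x, i x = y).
Proof.
pose N : lmodType R := submod (prop_pred Wc).
have lv : linear (fun x : N => submod_val x) by [].
exists N, (linear_map_of lv).
split=> [x|y]; first by rewrite linear_map_ofE => x0; apply: val_inj.
split=> [Wy|[x <-]]; last by rewrite linear_map_ofE; have /asboolP := valP x.
have yW : y \in prop_pred Wc by apply/asboolP.
by exists (Submod yW); rewrite linear_map_ofE.
Qed.

Lemma exists_quotient : exists (N : lmodType R) (g : {linear M -> N}),
  (forall z, exists y, g y = z) /\ (forall y, g y = 0 <-> W y).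
Proof.
pose N : lmodType R := quotmod (prop_pred Wc).
pose g : {linear M -> N} := @quotmod_pi _ _ (prop_pred Wc).
exists N, g; split=> [z|y]; first by exists (quotmod_repr z); apply: quotmod_reprK.
rewrite -(linear0 g); split=> [/quotmod_piP|Wy]; first by rewrite subr0 => /asboolP.
by apply/quotmod_piP; rewrite subr0; apply/asboolP.
Qed.

End SubQuotient.

Section SubQuotientSes.
Variable R : pzRingType.
Implicit Types U V W X Y Z : lmodType R.

Lemma kernel_ses Y Z (g : {linear Y -> Z}) : (forall z, exists y, g y = z) ->
  exists (X : lmodType R) (i : {linear X -> Y}), ses i g.
Proof.
move=> gs.
have Wc : g 0 = 0 /\ forall a x y, g x = 0 -> g y = 0 -> g (a *: x + y) = 0.
  split=> [|a x y gx gy]; first by rewrite linear0.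
  by rewrite linearP gx gy scaler0 addr0.
have [X [i [iinj iE]]] := exists_submodule (W := fun y => g y = 0) Wc.
by exists X, i; split=> // [x|y /iE//]; apply/iE; exists x.
Qed.

(** Every linear map is a surjection followed by an injection. *)
Lemma image_factor X Y (g : {linear X -> Y}) :
  exists (I : lmodType R) (p : {linear X -> I}) (i : {linear I -> Y}),
  [/\ forall z, exists x, p x = z, forall z, i z = 0 -> z = 0
    & forall x, i (p x) = g x].
Proof.
have Wc : (exists x, g x = 0) /\ forall a y z, (exists x, g x = y) ->
    (exists x, g x = z) -> (exists x, g x = a *: y + z).
  split=> [|a _ _ [x <-] [x' <-]]; first by exists 0; rewrite linear0.
  by exists (a *: x + x'); rewrite linearP.
have [I [i [iinj iE]]] := exists_submodule (W := fun y => exists x, g x = y) Wc.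
have [|p pE] := factor_inj (h := g) iinj; first by move=> x; apply/iE; exists x.
exists I, p, i; split=> // z; have [x gx] : exists x, g x = i z by apply/iE; exists z.
exists x; apply/eqP; rewrite -subr_eq0; apply/eqP/iinj.
by apply/subl_eq0; rewrite pE.
Qed.

Lemma cokernel_ses X Y (i : {linear X -> Y}) : (forall x, i x = 0 -> x = 0) ->
  exists (Z : lmodType R) (g : {linear Y -> Z}), ses i g.
Proof.
move=> iinj.
have Wc : (exists x, i x = 0) /\ forall a y z, (exists x, i x = y) ->
    (exists x, i x = z) -> (exists x, i x = a *: y + z).
  split=> [|a _ _ [x <-] [x' <-]]; first by exists 0; rewrite linear0.
  by exists (a *: x + x'); rewrite linearP.
have [Z [g [gs gE]]] := exists_quotient (W := fun y => exists x, i x = y) Wc.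
by exists Z, g; split=> // [x|y /gE//]; apply/gE; exists x.
Qed.

End SubQuotientSes.

(** * Direct sums of copies of a module *)

Section DirectSum.
Variables (R : pzRingType) (I : choiceType) (M : lmodType R).

(** Functions I -> M with finite support. *)
Definition finsupp_pred : {pred I -> M} :=
  fun f => `[< exists s : seq I, forall i, i \notin s -> f i = 0 >].

Fact finsupp_closed : submod_closed finsupp_pred.
Proof.
split=> [|a f g /asboolP[s sf] /asboolP[t tg]]; apply/asboolP; first by exists [::].
exists (s ++ t) => i; rewrite mem_cat negb_or => /andP[/sf fi /tg gi].
by rewrite -[LHS]/(a *: f i + g i) fi gi scaler0 addr0.
Qed.

HB.instance Definition _ := GRing.isSubmodClosed.Build R (I -> M) finsupp_pred
  finsupp_closed.

(** The direct sum of copies of M indexed by I: finitely supported functions. *)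
Definition dsum : lmodType R := submod finsupp_pred.

Fact dproj_linear j : linear (fun d : dsum => submod_val d j).
Proof. by []. Qed.

(** The projection to the summand with index j. *)
Definition dproj j : {linear dsum -> M} := linear_map_of (dproj_linear j).

Lemma dsum_eq (d d' : dsum) : (forall j, dproj j d = dproj j d') -> d = d'.
Proof.
by move=> dd'; apply/val_inj/funext => j; move: (dd' j); rewrite !linear_map_ofE.
Qed.

Fact dinj_subproof i (x : M) :
  (fun j => if j == i then x else 0) \in finsupp_pred.
Proof. by apply/asboolP; exists [:: i] => j; rewrite inE => /negbTE ->. Qed.

Definition dinj_fun i x : dsum := Submod (dinj_subproof i x).

Fact dinj_linear i : linear (dinj_fun i).
Proof.
move=> a x y; apply/dsum_eq => j; rewrite !linear_map_ofE.
rewrite -[RHS]/(a *: (if j == i then x else 0) + (if j == i then y else 0)) /=.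
case: (j == i); first reflexivity.
by rewrite scaler0 addr0.
Qed.

(** The inclusion of the summand with index i. *)
Definition dinj i : {linear M -> dsum} := linear_map_of (dinj_linear i).

Lemma dproj_inj i j x : dproj j (dinj i x) = if j == i then x else 0.
Proof. by rewrite !linear_map_ofE. Qed.

Fact dsupp_subproof (d : dsum) :
  exists s : seq I, uniq s /\ forall i, i \notin s -> dproj i d = 0.
Proof.
have /asboolP[s sP] := valP d; exists (undup s); rewrite undup_uniq.
by split=> // i; rewrite mem_undup linear_map_ofE => /sP.
Qed.

Lemma dsum_decomp (d : dsum) : exists s : seq I,
  (forall i, i \notin s -> dproj i d = 0) /\ d = \sum_(i <- s) dinj i (dproj i d).
Proof.
have [s [us sP]] := dsupp_subproof d; exists s; split=> //.
apply: dsum_eq => j; rewrite linear_sum; case: (boolP (j \in s)) => js.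
  rewrite (bigD1_seq j) //= dproj_inj eqxx big1 ?addr0 // => i /negbTE ij.
  by rewrite dproj_inj eq_sym ij.
rewrite sP // big1_seq // => i /= is_.
by rewrite dproj_inj ifF //; apply/negbTE; apply: contraNN js => /eqP ->.
Qed.

Lemma dsum_ind (P : dsum -> Prop) :
  P 0 -> (forall x y, P x -> P y -> P (x + y)) ->
  (forall i x, P (dinj i x)) -> forall d, P d.
Proof.
by move=> P0 PD Pi d; have [s [_ ->]] := dsum_decomp d; apply: big_ind.
Qed.

Section Case.
Variables (N : lmodType R) (h : I -> {linear M -> N}).

(* A chosen support; by dcase_funE the sum does not depend on it. *)
Let dsupp (d : dsum) := xget [::] [set s : seq I | uniq s /\
  forall i, i \notin s -> dproj i d = 0]%classic.

Definition dcase_fun (d : dsum) : N := \sum_(i <- dsupp d) h i (dproj i d).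

Let dcase_funE d (s : seq I) : uniq s -> (forall i, i \notin s -> dproj i d = 0) ->
  dcase_fun d = \sum_(i <- s) h i (dproj i d).
Proof.
move=> us sP; have [ut tP] : uniq (dsupp d) /\
    forall i, i \notin dsupp d -> dproj i d = 0.
  rewrite /dsupp; case: xgetP => [t _ //|no].
  by have [t tP] := dsupp_subproof d; case: (no t).
rewrite /dcase_fun; move: (dsupp d) ut tP => t ut tP.
rewrite (bigID [in s]) /= [X in _ + X]big1 ?addr0 => [|i /sP ->]; last exact: linear0.
rewrite [RHS](bigID [in t]) /= [X in _ = _ + X]big1 ?addr0; last first.
  by move=> i /tP ->; apply: linear0.
rewrite -[LHS]big_filter -[RHS]big_filter; apply: perm_big; apply: uniq_perm; rewrite ?filter_uniq //.
by move=> i; rewrite !mem_filter andbC.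
Qed.

Fact dcase_linear : linear dcase_fun.
Proof.
move=> a d d'; have [s [us sP]] := dsupp_subproof d.
have [t [ut tP]] := dsupp_subproof d'; pose w := undup (s ++ t).
have wP i : i \notin w -> dproj i d = 0 /\ dproj i d' = 0.
  by rewrite mem_undup mem_cat negb_or => /andP[/sP -> /tP ->].
have wE x : (forall i, i \notin w -> dproj i x = 0) ->
    dcase_fun x = \sum_(i <- w) h i (dproj i x).
  by apply: dcase_funE; rewrite undup_uniq.
rewrite !wE => [|i /wP[]|i /wP[]|i /wP[d0 d'0]] //; last first.
  by rewrite linearP d0 d'0 scaler0 addr0.
by rewrite scaler_sumr -big_split; apply: eq_bigr => i _; rewrite !linearP.
Qed.

(** The map out of the direct sum that is h i on the i-th summand. *)
Definition dcase : {linear dsum -> N} := linear_map_of dcase_linear.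

Lemma dcase_inj i x : dcase (dinj i x) = h i x.
Proof.
rewrite linear_map_ofE (@dcase_funE _ [:: i]) //; last first.
  by move=> j; rewrite inE dproj_inj => /negbTE ->.
by rewrite big_seq1 dproj_inj eqxx.
Qed.

End Case.
End DirectSum.
Arguments dinj {R I M}.
Arguments dproj {R I M}.
Arguments dcase {R I M N}.

Section DirectSumMap.
Variables (R : pzRingType) (I : choiceType).
Implicit Types U V W : lmodType R.

Lemma dsum_ext V W (a b : {linear dsum I V -> W}) :
  (forall i x, a (dinj i x) = b (dinj i x)) -> forall d, a d = b d.
Proof.
move=> ab; apply: dsum_ind => //; first by rewrite !linear0.
by move=> x y ax ay; rewrite !linearD ax ay.
Qed.

(** The map between direct sums that is h on each summand. *)
Definition dmap U V (h : {linear U -> V}) : {linear dsum I U -> dsum I V} :=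
  dcase (fun i => dinj i \o h).

Lemma dmap_inj U V (h : {linear U -> V}) i x : dmap h (dinj i x) = dinj i (h x).
Proof. exact: dcase_inj. Qed.

Lemma dproj_map U V (h : {linear U -> V}) i d : dproj i (dmap h d) = h (dproj i d).
Proof.
apply: (dsum_ext (a := dproj i \o dmap h) (b := h \o dproj i)) => j x /=.
rewrite dmap_inj !dproj_inj.
by case: eqP => // _; rewrite linear0.
Qed.

Lemma dsum_ses U V W (i : {linear U -> V}) (g : {linear V -> W}) :
  ses i g -> ses (dmap i) (dmap g).
Proof.
move=> [iinj gs gi ex]; split.
- move=> d /= d0; apply: dsum_eq => j; rewrite linear0; apply: iinj.
  by rewrite -dproj_map d0 linear0.
- apply: dsum_ind => [|x y [a <-] [b <-]|j x]; first by exists 0; rewrite linear0.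
    by exists (a + b); rewrite linearD.
  by have [y <-] := gs x; exists (dinj j y); rewrite dmap_inj.
- by move=> d; apply: dsum_eq => j; rewrite !dproj_map gi linear0.
- move=> d gd; have [s [_ ->]] := dsum_decomp d.
  have P0 : exists x, dmap i x = 0 by exists 0; rewrite linear0.
  have PD x y : (exists a, dmap i a = x) -> (exists a, dmap i a = y) ->
      exists a, dmap i a = x + y.
    by move=> [a <-] [b <-]; exists (a + b); rewrite linearD.
  apply: (big_ind (fun y => exists x, dmap i x = y)) => // j _.
  have [|x <-] := ex (dproj j d); first by rewrite -dproj_map gd linear0.
  by exists (dinj j x); rewrite dmap_inj.
Qed.

End DirectSumMap.

(** * Projective modules *)

Section Projective.
Variable R : pzRingType.
Implicit Types U V W X Y Z P : lmodType R.

Lemma projective_retract P U (a : {linear P -> U}) (b : {linear U -> P}) :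
  (forall p, b (a p) = p) -> projective U -> projective P.
Proof.
move=> ba pU M N g f gs; have [h hE] := pU _ _ g (f \o b) gs.
by exists (h \o a) => p /=; rewrite hE /= ba.
Qed.

Lemma projective_dsum I P : projective P -> projective (dsum I P).
Proof.
move=> pP M N g f gs.
have /choice[h hE] i : exists h : {linear P -> M}, forall p, g (h p) = f (dinj i p).
  by have [h hE] := pP _ _ g (f \o dinj i) gs; exists h.
exists (dcase h); apply: (dsum_ext (a := g \o dcase h)) => i p /=.
by rewrite dcase_inj hE.
Qed.

Fact scale_linear (U : lmodType R) (u : U) : linear (fun r : R^o => (r : R) *: u).
Proof. by move=> a x y; rewrite scalerDl scalerA. Qed.

Lemma projective_regular : projective (R^o : lmodType R).
Proof.
move=> M N g f gs; have [m mE] := gs (f 1).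
exists (linear_map_of (scale_linear m)) => r; rewrite linear_map_ofE.
rewrite linearZ mE -linearZ; congr (f _); exact: mulr1.
Qed.

Lemma enough_projectives (M : lmodType R) : exists (K P : lmodType R) (j : {linear K -> P})
  (p : {linear P -> M}), projective P /\ ses j p.
Proof.
pose P := dsum M (R^o : lmodType R).
pose p : {linear P -> M} := dcase (fun m => linear_map_of (scale_linear m)).
have [m|K [j sj]] := kernel_ses (g := p); last first.
  by exists K, P, j, p; split=> //; apply/projective_dsum/projective_regular.
by exists (dinj m (1 : R^o)); rewrite dcase_inj linear_map_ofE scale1r.
Qed.

End Projective.

(** * Vanishing of Ext by dimension shifting *)

Section ExtVanishing.
Variables (R : pzRingType) (N : lmodType R).
Implicit Types K M P Q U W X Y Z : lmodType R.

(** [extends i]: every linear map X -> N extends along i : X -> Y. *)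
Definition extends X Y (i : {linear X -> Y}) : Prop :=
  forall h : {linear X -> N}, exists h' : {linear Y -> N}, forall x, h' (i x) = h x.

(** [ext_vanish m M] says that Ext^m(M, N) = 0. For m = 0, every map M -> N is
    zero; for m = 1, maps to N extend along the kernel of any surjection onto M
    (equivalently, by pushout, every extension of M by N splits); for m > 1,
    Ext^(m-1)(K, N) = 0 for the kernel K of every projective presentation of M.
    Since M ranges over all modules, this needs no choice of a resolution. *)
Fixpoint ext_vanish (m : nat) M : Prop :=
  match m with
  | 0 => forall (h : {linear M -> N}) x, h x = 0
  | 1 => forall X Y (i : {linear X -> Y}) (g : {linear Y -> M}),
           ses i g -> extends i
  | m'.+1 => forall K P (j : {linear K -> P}) (p : {linear P -> M}),
           projective P -> ses j p -> ext_vanish m' K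
  end.

Lemma ext_vanish_kernel m K P M (j : {linear K -> P}) (p : {linear P -> M}) :
  projective P -> ses j p -> ext_vanish m.+2 M -> ext_vanish m.+1 K.
Proof. by move=> pP sj ev; exact: (ev _ _ _ _ pP sj). Qed.

(** For m = 1 a single projective presentation P -> M suffices: if Y maps onto M
    with kernel X, then P -> M lifts to Y and X (+) P maps onto Y. *)
Lemma ext1_presentation K P M (j : {linear K -> P}) (p : {linear P -> M}) :
  projective P -> ses j p -> extends j -> ext_vanish 1 M.
Proof.
move=> pP [jinj ps pj pex] ext X Y i g [iinj gs gi gex] h.
have [l lE] := pP _ _ g p gs.
have [|kap kapE] := factor_inj (h := l \o j) iinj.
  by move=> w; apply: gex; rewrite /= lE pj.
have [t tE] := ext (h \o kap).
pose c : {linear (X * P)%type -> Y} := (i \o fst) \+ (l \o snd).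
pose d : {linear (X * P)%type -> N} := (h \o fst) \+ (t \o snd).
have cs y : exists z, c z = y.
  have [q qE] := ps (g y).
  have [|x xE] := gex (y - l q); first by apply/subl_eq0; rewrite lE.
  by exists (x, q); rewrite /= xE subrK.
have [[x q] /= c0|h' h'E] := factor_surj (h := d) cs.
  have [|w wE] := pex q.
    by rewrite -lE -[LHS]add0r -(gi x) -linearD c0 linear0.
  have xE : x + kap w = 0.
    by apply: iinj; rewrite linearD kapE /= wE.
  by rewrite -wE tE /= -linearD xE linear0.
exists h' => x; have := h'E (x, 0); rewrite /= !linear0 !addr0 => <-.
by rewrite -[i x]addr0 -(linear0 l).
Qed.

(** M is a retract of M' up to maps factoring through a projective module. *)
Definition stable_retract M M' : Prop :=
  exists (a : {linear M -> M'}) (b : {linear M' -> M}) Q (u : {linear M -> Q})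
    (v : {linear Q -> M}), projective Q /\ forall x, x = b (a x) + v (u x).

(** Being a stable retract passes to kernels of projective presentations: lift
    the maps to the presentations; the difference between the identity and the
    sum of the lifts maps P to K. *)
Lemma stable_retract_kernel M M' K P K' P' (j : {linear K -> P})
    (p : {linear P -> M}) (j' : {linear K' -> P'}) (p' : {linear P' -> M'}) :
  stable_retract M M' -> projective P -> projective P' -> ses j p -> ses j' p' ->
  exists (at_ : {linear P -> P'}) (a : {linear K -> K'}) (b : {linear K' -> K})
    (w : {linear P -> K}), [/\ forall x, j' (a x) = at_ (j x)
      & forall x, x = b (a x) + w (j x)].
Proof.
move=> [a [b [Q [u [v [pQ abuv]]]]]] pP pP' [jinj ps pj pex] [j'inj p's p'j' p'ex].
have [A AE] := pP _ _ p' (a \o p) p's.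
have [B BE] := pP' _ _ p (b \o p') ps.
have [v' v'E] := pQ _ _ p v ps.
have [|a' a'E] := factor_inj (h := A \o j) j'inj.
  by move=> x; apply: p'ex; rewrite /= AE /= pj linear0.
have [|b' b'E] := factor_inj (h := B \o j') jinj.
  by move=> x; apply: pex; rewrite /= BE /= p'j' linear0.
pose W : {linear P -> P} := idfun \- ((B \o A) \+ (v' \o u \o p)).
have [|w wE] := factor_inj (h := W) jinj.
  move=> x; apply: pex; rewrite /W /= linearB linearD BE /= AE /= v'E.
  by rewrite -abuv subrr.
exists A, a', b', w; split=> // x.
apply/eqP; rewrite -subr_eq0; apply/eqP/jinj.
rewrite linearB linearD wE b'E /= a'E /W /= pj !linear0 addr0.
by rewrite addrCA subrr addr0 subrr.
Qed.

Lemma ext_vanish_stable m M M' :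
  stable_retract M M' -> ext_vanish m.+1 M' -> ext_vanish m.+1 M.
Proof.
elim: m M M' => [|m IH] M M' sr.
  move=> ev; have [K [P [j [p [pP sj]]]]] := enough_projectives M.
  have [K' [P' [j' [p' [pP' sj']]]]] := enough_projectives M'.
  have [A [a [b [w [aE wE]]]]] := stable_retract_kernel sr pP pP' sj sj'.
  apply: (ext1_presentation pP sj) => h; have [t tE] := ev _ _ _ _ sj' (h \o b).
  exists ((t \o A) \+ (h \o w)) => x /=.
  by rewrite -aE tE /= -linearD -wE.
move=> ev K P j p pP sj.
have [K' [P' [j' [p' [pP' sj']]]]] := enough_projectives M'.
have [A [a [b [w [aE wE]]]]] := stable_retract_kernel sr pP pP' sj sj'.
apply: (IH K K'); last exact: ext_vanish_kernel pP' sj' ev.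
by exists a, b, P, j, w.
Qed.

Lemma stable_retract_refl M : stable_retract M M.
Proof.
exists idfun, idfun, (R^o : lmodType R), \0, \0; split; first exact: projective_regular.
by move=> x; rewrite /= addr0.
Qed.

Lemma ext_vanishS_presentation m K P M (j : {linear K -> P}) (p : {linear P -> M}) :
  projective P -> ses j p -> ext_vanish m.+1 K -> ext_vanish m.+2 M.
Proof.
move=> pP sj ev K' P' j' p' pP' sj'.
have [A [a [b [w [aE wE]]]]] :=
  stable_retract_kernel (stable_retract_refl M) pP' pP sj' sj.
by apply: ext_vanish_stable ev; exists a, b, P', j', w.
Qed.

Lemma ext_vanish_retract m M M' (a : {linear M -> M'}) (b : {linear M' -> M}) :
  (forall x, b (a x) = x) -> ext_vanish m M' -> ext_vanish m M.
Proof.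
move=> ba; case: m => [ev h x|m].
  by have := ev (h \o b) (a x); rewrite /= ba.
apply: ext_vanish_stable; exists a, b, (R^o : lmodType R), \0, \0.
split=> [|x]; first exact: projective_regular.
by rewrite ba addr0.
Qed.

Lemma ses_projective_split X Y Z (i : {linear X -> Y}) (g : {linear Y -> Z}) :
  projective Z -> ses i g -> exists r : {linear Y -> X}, forall x, r (i x) = x.
Proof.
move=> pZ [iinj gs gi gex]; have [t tE] := pZ _ _ g idfun gs.
have [y|r rE] := factor_inj (h := idfun \- (t \o g)) iinj.
  by apply: gex; rewrite /= linearB tE subrr.
exists r => x; apply/eqP; rewrite -subr_eq0; apply/eqP/iinj.
by rewrite linearB rE /= gi linear0 subr0 subrr.
Qed.

Lemma ext_vanish_projective m M : projective M -> ext_vanish m.+1 M.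
Proof.
elim: m M => [|m IH] M pM X Y i g.
  move=> sig h; have [r rE] := ses_projective_split pM sig.
  by exists (h \o r) => x /=; rewrite rE.
move=> pY sig; have [r rE] := ses_projective_split pM sig.
exact/IH/(projective_retract rE).
Qed.

(** The rotated sequence 0 -> W -> X (+) P -> Y -> 0, where W is the kernel of a
    projective presentation P -> Z. *)
Lemma ses_rotate W P X Y Z (j : {linear W -> P}) (p : {linear P -> Z})
    (i : {linear X -> Y}) (g : {linear Y -> Z}) :
  projective P -> ses j p -> ses i g ->
  exists (k : {linear W -> (X * P)%type}) (c : {linear (X * P)%type -> Y}),
    [/\ ses k c, forall w, (k w).2 = j w & forall x, c (x, 0) = i x].
Proof.
move=> pP [jinj ps pj pex] [iinj gs gi gex].
have [l lE] := pP _ _ g p gs.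
have [|kap kapE] := factor_inj (h := l \o j) iinj.
  by move=> w; apply: gex; rewrite /= lE pj.
have lk : linear (fun w => (- kap w, j w) : (X * P)%type).
  by move=> a x y; congr (_, _); rewrite /= linearP // opprD scalerN.
exists (linear_map_of lk), ((i \o fst) \+ (l \o snd)).
split=> [|w|x]; last 2 first.
- by rewrite linear_map_ofE.
- by rewrite /= linear0 addr0.
split.
- by move=> w; rewrite linear_map_ofE => -[_ /jinj].
- move=> y; have [q qE] := ps (g y).
  have [|x xE] := gex (y - l q); first by apply/subl_eq0; rewrite lE.
  by exists (x, q); rewrite /= xE subrK.
- by move=> w; rewrite linear_map_ofE /= linearN kapE addNr.
- move=> [x q] /= c0; have [|w wE] := pex q.
    by rewrite -lE -[LHS]add0r -(gi x) -linearD c0 linear0.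
  exists w; rewrite linear_map_ofE wE; congr (_, _).
  apply/eqP; rewrite -subr_eq0; apply/eqP/iinj/subl_eq0; apply/eqP.
  by rewrite linearN kapE /= wE eq_sym -addr_eq0 c0.
Qed.

Lemma stable_retract_prod X P : projective P -> stable_retract (X * P)%type X.
Proof.
move=> pP.
have l1 : linear (fun x : X => (x, 0) : (X * P)%type).
  by move=> a x y; congr (_, _); rewrite /= scaler0 addr0.
have l2 : linear (fun q : P => (0, q) : (X * P)%type).
  by move=> a x y; congr (_, _); rewrite /= scaler0 addr0.
exists fst, (linear_map_of l1), P, snd, (linear_map_of l2); split=> // -[x q].
by rewrite !linear_map_ofE; congr (_, _); rewrite /= ?addr0 ?add0r.
Qed.

Lemma ext_vanish_prod m X P : projective P ->
  ext_vanish m.+1 X -> ext_vanish m.+1 (X * P)%type.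
Proof. by move=> pP; exact/ext_vanish_stable/stable_retract_prod. Qed.

Lemma ext_vanish_fst m X P : ext_vanish m (X * P)%type -> ext_vanish m X.
Proof.
have l1 : linear (fun x : X => (x, 0) : (X * P)%type).
  by move=> a x y; congr (_, _); rewrite /= scaler0 addr0.
apply: (@ext_vanish_retract m _ _ (linear_map_of l1) fst) => x.
by rewrite linear_map_ofE.
Qed.

(** Middle exactness: Ext^m(X, N) = Ext^m(Z, N) = 0 implies Ext^m(Y, N) = 0. *)
Definition ext_mid m := forall X Y Z (i : {linear X -> Y}) (g : {linear Y -> Z}),
  ses i g -> ext_vanish m X -> ext_vanish m Z -> ext_vanish m Y.

(** Left exactness: Ext^m(Y, N) = Ext^(m+1)(Z, N) = 0 implies
    Ext^m(X, N) = 0. *)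
Definition ext_left m := forall X Y Z (i : {linear X -> Y}) (g : {linear Y -> Z}),
  ses i g -> ext_vanish m Y -> ext_vanish m.+1 Z -> ext_vanish m X.

Lemma ext_mid1 : ext_mid 1.
Proof.
move=> X Y Z i g [iinj gs gi gex] evX evZ U E a b [ainj bs ba bex] h.
have gbs z : exists x, (g \o b) x = z.
  by have [y <-] := gs z; have [x <-] := bs y; exists x.
have [W [w sw]] := kernel_ses gbs; have [winj _ gbw gbex] := sw.
have [|u uE] := factor_inj (h := a) winj.
  by move=> x; apply: gbex; rewrite /= ba linear0.
have [|v vE] := factor_inj (h := b \o w) iinj.
  by move=> x; apply: gex; apply: gbw.
have suv : ses u v.
  split=> [x ux|x|x|y vy].
  - by apply: ainj; rewrite -uE ux linear0.
  - have [y yE] := bs (i x); have [|z zE] := gbex y; first by rewrite /= yE gi.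
    exists z; apply/eqP; rewrite -subr_eq0; apply/eqP/iinj/subl_eq0.
    by rewrite vE /= zE yE.
  - by apply: iinj; rewrite vE /= uE ba.
  have [|x xE] := bex (w y); first by rewrite -[LHS]vE vy linear0.
  exists x; apply/eqP; rewrite -subr_eq0; apply/eqP/winj/subl_eq0.
  by rewrite uE xE.
have [t tE] := evX _ _ _ _ suv h; have [t' t'E] := evZ _ _ _ _ sw t.
by exists t' => x; rewrite -uE t'E tE.
Qed.

Lemma ext_left_mid m : ext_mid m.+1 -> ext_left m.+1.
Proof.
move=> mid X Y Z i g sig evY evZ.
have [W [P [j [p [pP sj]]]]] := enough_projectives Z.
have [k [c [skc _ _]]] := ses_rotate pP sj sig.
apply/(@ext_vanish_fst _ _ P)/(mid _ _ _ _ _ skc); last exact: evY.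
exact: ext_vanish_kernel pP sj evZ.
Qed.

Lemma ext_mid_left m : ext_left m.+1 -> ext_mid m.+2.
Proof.
move=> left X Y Z i g sig evX evZ.
have [W [P [j [p [pP sj]]]]] := enough_projectives Z.
have [k [c [skc _ _]]] := ses_rotate pP sj sig.
have [W' [P' [j' [p' [pP' sj']]]]] := enough_projectives Y.
have [k' [c' [skc' _ _]]] := ses_rotate pP' sj' skc.
apply: (ext_vanishS_presentation pP' sj'); apply: (left _ _ _ _ _ skc').
  exact/(ext_vanish_prod pP')/(ext_vanish_kernel pP sj).
exact: ext_vanish_prod.
Qed.

(** The two properties follow from each other by rotation, in turn in each
    degree. *)
Lemma ext_vanish_left m X Y Z (i : {linear X -> Y}) (g : {linear Y -> Z}) :
  ses i g -> ext_vanish m.+1 Y -> ext_vanish m.+2 Z -> ext_vanish m.+1 X.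
Proof.
suff [+ _] : ext_left m.+1 /\ ext_mid m.+1 by apply.
elim: m => [|m [lm mm]]; first by split; [apply: ext_left_mid|]; apply: ext_mid1.
by have mm' := ext_mid_left lm; split=> //; apply: ext_left_mid.
Qed.

(** Right exactness: Ext^m(X, N) = Ext^(m+1)(Y, N) = 0 implies
    Ext^(m+1)(Z, N) = 0. *)
Lemma ext_vanish_right m X Y Z (i : {linear X -> Y}) (g : {linear Y -> Z}) :
  ses i g -> ext_vanish m X -> ext_vanish m.+1 Y -> ext_vanish m.+1 Z.
Proof.
move=> sig evX evY.
have [W [P [j [p [pP sj]]]]] := enough_projectives Z.
have [k [c [skc kE cE]]] := ses_rotate pP sj sig.
case: m evX evY => [|m] evX evY.
  apply: (ext1_presentation pP sj) => h; have [t tE] := evY _ _ _ _ skc h.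
  have l1 : linear (fun x : X => (x, 0) : (X * P)%type).
    by move=> a x y; congr (_, _); rewrite /= scaler0 addr0.
  have l2 : linear (fun q : P => (0, q) : (X * P)%type).
    by move=> a x y; congr (_, _); rewrite /= scaler0 addr0.
  exists (t \o linear_map_of l2) => w; rewrite /= linear_map_ofE -tE -kE.
  have := evX (t \o linear_map_of l1) (k w).1; rewrite /= linear_map_ofE => t0.
  rewrite -[LHS]add0r -t0 -linearD; congr (t _).
  by case: (k w) => x q; congr (_, _); rewrite /= ?addr0 ?add0r.
apply: (ext_vanishS_presentation pP sj); apply: (ext_vanish_left skc) => //.
exact: ext_vanish_prod.
Qed.

Lemma ext_vanish_dsum m (I : choiceType) M :
  ext_vanish m.+1 M -> ext_vanish m.+1 (dsum I M).
Proof.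
elim: m M => [|m IH] M ev; have [K [P [j [p [pP sj]]]]] := enough_projectives M;
  have sdj := dsum_ses I sj; have pdP := projective_dsum (I := I) pP.
  apply: (ext1_presentation pdP sdj) => h.
  have /choice[t tE] i : exists t : {linear P -> N}, forall x, t (j x) = h (dinj i x).
    by have [t tE] := ev _ _ _ _ sj (h \o dinj i); exists t.
  exists (dcase t); apply: (dsum_ext (a := dcase t \o dmap I j)) => i x /=.
  by rewrite dmap_inj dcase_inj tE.
by apply: (ext_vanishS_presentation pdP sdj); apply: IH; apply: ext_vanish_kernel pP sj ev.
Qed.

End ExtVanishing.

Section Resolution.
Variable R : pzRingType.
Implicit Types M N K : lmodType R.

(** The kernel of the augmentation, resolved by the rest of the resolution. *)
Lemma resolution_shift M (P : projective_resolution M) :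
  exists K (Q : projective_resolution K) (j : {linear K -> P 0%N}),
  ses j (res_aug P) /\
  (forall N n, (forall f : {linear P n.+2 -> N}, cocycle f -> coboundary f) <->
                  (forall f : {linear Q n.+1 -> N}, cocycle f -> coboundary f)).
Proof.
have [K [j sj]] := kernel_ses (@res_aug_surj _ _ P); have [jinj _ aj aex] := sj.
have [|a aE] := factor_inj (h := res_d P 0) jinj.
  by move=> x; apply: aex; apply/res_exact0; exists x.
have as_ x : exists p, a p = x.
  have /res_exact0[q qE] := aj x; exists q.
  by apply/eqP; rewrite -subr_eq0; apply/eqP/jinj/subl_eq0; rewrite aE.
have aex0 p : a p = 0 <-> exists q, res_d P 1 q = p.
  rewrite -res_exact -aE; split=> [->|/jinj//]; exact: linear0.
exists K, (ProjectiveResolution (fun n => @res_projective _ _ P n.+1) as_ aex0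
  (fun n => @res_exact _ _ P n.+1)), j.
by split.
Qed.

(** The vanishing of Ext is that of the cohomology of any projective resolution. *)
Lemma ext_vanish_resolution m M N (P : projective_resolution M) :
  ext_vanish N m.+1 M <->
  (forall f : {linear P m.+1 -> N}, cocycle f -> coboundary f).
Proof.
elim: m M P => [|m IH] M P; have [K [Q [j [sj QP]]]] := resolution_shift P.
  have [jinj _ aj aex] := sj.
  have [|a aE] := factor_inj (h := res_d P 0) jinj.
    by move=> x; apply: aex; apply/res_exact0; exists x.
  have as_ x : exists p, a p = x.
    have /res_exact0[q qE] := aj x; exists q.
    by apply/eqP; rewrite -subr_eq0; apply/eqP/jinj/subl_eq0; rewrite aE.
  split=> [ev f cf|ext].
    have [p ap|h hE] := factor_surj (h := f) as_.
      have /res_exact[q <-] : res_d P 0 p = 0 by rewrite -aE ap linear0.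
      exact: cf.
    have [t tE] := ev _ _ _ _ sj h; exists t => p.
    by rewrite -aE tE hE.
  apply: (ext1_presentation _ sj) => [|h]; first exact: res_projective.
  have [|t tE] := ext (h \o a).
    move=> q /=; rewrite (_ : a _ = 0) ?linear0 //; apply: jinj.
    by rewrite aE; apply/res_exact; exists q.
  by exists t => x; have [p <-] := as_ x; rewrite aE -tE.
rewrite QP -IH; split=> [ev|]; first exact: ext_vanish_kernel (@res_projective _ _ P 0) sj ev.
exact: ext_vanishS_presentation (@res_projective _ _ P 0) sj.
Qed.

Lemma finite_pd_ext_vanish M : finite_pd M ->
  exists n, forall m N, (n <= m)%N -> ext_vanish N m.+1 M.
Proof.
move=> [P [n P0]]; exists n => m N nm; apply/(ext_vanish_resolution _ _ P) => f _.
exists \0 => p /=; rewrite (P0 _ _ p) ?linear0 //.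
Qed.

End Resolution.

(** * Modules over a corner ring *)

Section Corner.
Variables (R : pzRingType) (f : R) (ff : f * f = f).
Implicit Types M N K Q : rmodType R.

Fact eR_gen_subproof : f \in eR_pred f.
Proof. by apply/asboolP; exists 1; rewrite mulr1. Qed.

(** The generator f of fR. *)
Definition eR_gen : eR f :=
  @Submod _ _ (eR_pred f : submodClosed _) _ eR_gen_subproof.

Lemma eR_genE (x : eR f) : x = (submod_val x : R^c) *: eR_gen.
Proof.
apply: val_inj; have /asboolP[a xa] := valP x.
rewrite -[RHS]/(f * (submod_val x : R)) [X in _ * X]xa mulrA ff.
by rewrite -xa.
Qed.

Fact eR_act_linear M (m : M) : linear (fun x : eR f => (submod_val x : R^c) *: m).
Proof.
move=> a x y; rewrite scalerA -scalerDl; congr (_ *: _).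
Qed.

(** The map fR -> M given by x |-> m x. *)
Definition eR_act M (m : M) : {linear eR f -> M} :=
  linear_map_of (eR_act_linear m).

Lemma eR_actE M (m : M) x : eR_act m x = (submod_val x : R^c) *: m.
Proof. exact: linear_map_ofE. Qed.

Lemma eR_homE M (h : {linear eR f -> M}) : h =1 eR_act (h eR_gen).
Proof. by move=> x; rewrite eR_actE -linearZ -eR_genE. Qed.

Lemma eR_projective : projective (eR f : rmodType R).
Proof.
move=> M N g h gs; have [m mE] := gs (h eR_gen).
exists (eR_act m) => x; rewrite (eR_homE h) !eR_actE.
by rewrite linearZ mE.
Qed.

(** Qf = 0, or equivalently Hom(fR, Q) = 0. *)
Definition annihilated Q : Prop := forall x : Q, (f : R^c) *: x = 0.

Lemma annihilated_hom0 Q (h : {linear eR f -> Q}) x : annihilated Q -> h x = 0.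
Proof.
move=> Q0; have /asboolP[a xa] := valP x.
rewrite eR_homE eR_actE (_ : h eR_gen = 0) ?scaler0 //.
by rewrite [X in h X]eR_genE linearZ /= Q0.
Qed.

Local Notation F M := (cornerHom M ff : lmodType (corner ff)^c).

(** The elements of Hom(fR, M) as linear maps, and conversely. *)
Definition hom_linear M (phi : F M) : {linear eR f -> M} :=
  linear_map_of (modHomP phi).

Lemma hom_linearE M (phi : F M) x : hom_linear phi x = (phi : modHom _ _) x.
Proof. exact: linear_map_ofE. Qed.

Fact to_hom_subproof M (h : {linear eR f -> M}) :
  (h : eR f -> M) \in @linear_pred R^c (eR f) M.
Proof. by apply/asboolP => a x y; rewrite linearP. Qed.

Definition to_hom M (h : {linear eR f -> M}) : F M := ModHom (to_hom_subproof h).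

Lemma to_homE M (h : {linear eR f -> M}) x : (to_hom h : modHom _ _) x = h x.
Proof. by []. Qed.

Fact corner_map_linear M N (g : {linear M -> N}) :
  linear (fun phi : F M => to_hom (g \o hom_linear phi) : F N).
Proof.
move=> a phi psi; apply: modHom_ext => x.
rewrite to_homE /= !hom_linearE.
rewrite -[RHS]/(g (hom_linear phi (corner_act a x)) + g (hom_linear psi x)).
by rewrite -linearD !hom_linearE.
Qed.

(** The functor Hom(fR, -) on maps. *)
Definition corner_map M N (g : {linear M -> N}) : {linear F M -> F N} :=
  linear_map_of (corner_map_linear g).

Lemma corner_mapE M N (g : {linear M -> N}) phi x :
  (corner_map g phi : modHom _ _) x = g ((phi : modHom _ _) x).
Proof. by rewrite linear_map_ofE to_homE /= hom_linearE. Qed.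

Fact corner_of_subproof (z : eR f) : (submod_val z : R) * f \in corner_pred f.
Proof. by have /asboolP[a ->] := valP z; apply/asboolP; exists a. Qed.

(** The map z |-> z f from fR onto fRf. *)
Definition corner_of (z : eR f) : (corner ff)^c := Corner ff (corner_of_subproof z).

Section Cover.
Variable M : rmodType R.

(** The sum of copies of fR indexed by Hom(fR, M), and its evaluation map to M;
    the image of the latter is MfR, the trace of fR in M. *)
Definition cover : rmodType R := dsum (modHom (eR f) M) (eR f).

Definition cover_ev : {linear cover -> M} :=
  dcase (fun phi : modHom (eR f) M => hom_linear (phi : F M)).

Lemma cover_evE (phi : F M) x : cover_ev (dinj (phi : modHom _ _) x) =
  (phi : modHom _ _) x.
Proof. by rewrite dcase_inj hom_linearE. Qed.

Lemma cover_projective : projective cover.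
Proof. exact/projective_dsum/eR_projective. Qed.

(** The inclusion of the summand with index phi. *)
Definition cover_gen (phi : modHom (eR f) M) : F cover := to_hom (dinj phi).

(** Hom(fR, cover) is generated by the inclusions of the summands. *)
Lemma corner_cover_ind (P : F cover -> Prop) :
  P 0 -> (forall x y, P x -> P y -> P (x + y)) ->
  (forall phi (g : (corner ff)^c), P (g *: cover_gen phi)) -> forall psi, P psi.
Proof.
move=> P0 PD Pg psi.
have -> : psi = to_hom (eR_act (hom_linear psi eR_gen)).
  by apply: modHom_ext => x; rewrite to_homE -eR_homE hom_linearE.
elim/dsum_ind: (hom_linear psi eR_gen) => [|x y Px Py|phi z].
- rewrite (_ : to_hom _ = 0) //; apply: modHom_ext => x.
  by rewrite to_homE eR_actE scaler0.
- rewrite (_ : to_hom _ = to_hom (eR_act x) + to_hom (eR_act y)); first exact: PD.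
  by apply: modHom_ext => w; rewrite to_homE eR_actE scalerDr -!eR_actE.
rewrite (_ : to_hom _ = corner_of z *: cover_gen phi) //.
apply: modHom_ext => x; rewrite to_homE eR_actE -linearZ.
rewrite -[RHS]/(dinj phi (corner_act (corner_of z) x)); congr (dinj phi _).
apply: val_inj; have /asboolP[a xa] := valP x.
rewrite -[LHS]/((submod_val z : R) * (submod_val x : R)).
rewrite -[RHS]/((submod_val z : R) * f * (submod_val x : R)).
by rewrite xa !mulrA -[_ * f * f]mulrA ff.
Qed.

Let D : lmodType (corner ff)^c := dsum (modHom (eR f) M) ((corner ff)^c)^o.

(* An element of Hom(fR, cover) is given by the value at f, whose coordinates
   lie in fRf: this makes it an element of a free module over fRf. *)
Let coords_fun (psi : F cover) phi : ((corner ff)^c)^o :=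
  corner_of (dproj phi ((psi : modHom _ _) eR_gen)).

Fact coords_subproof psi :
  coords_fun psi \in @finsupp_pred _ (modHom (eR f) M) ((corner ff)^c)^o.
Proof.
have [s [sP _]] := dsum_decomp ((psi : modHom _ _) eR_gen).
apply/asboolP; exists s => phi /sP d0; apply: val_inj.
by rewrite /coords_fun d0 /= mul0r.
Qed.

(** The coordinates of psi, an element of a free fRf-module. *)
Definition coords psi : D :=
  @Submod _ _ (@finsupp_pred _ _ _ : submodClosed _) _ (coords_subproof psi).

Fact coords_linear : linear coords.
Proof.
move=> g x y; apply: dsum_eq => phi; rewrite linearP !linear_map_ofE /=.
apply: val_inj.
have xg : (x : modHom _ _) (corner_act g eR_gen) =
    (corner_val g : R^c) *: (x : modHom _ _) eR_gen.
  rewrite -!(hom_linearE x) -linearZ; congr (hom_linear x _).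
  apply: val_inj; rewrite -[LHS]/(corner_val g * f) -[RHS]/(f * corner_val g).
  have gP := corner_valP g; rewrite [LHS](corner_idr ff gP).
  exact/esym/(corner_idl ff gP).
rewrite -[LHS]/((submod_val (dproj phi ((x : modHom _ _) (corner_act g eR_gen) +
   (y : modHom _ _) eR_gen)) : R) * f).
rewrite xg linearP.
set u := dproj phi _; set v := dproj phi _.
rewrite -[LHS]/(((submod_val u : R) * corner_val g + (submod_val v : R)) * f).
rewrite -[RHS]/((submod_val u : R) * f * corner_val g + (submod_val v : R) * f).
have gP := corner_valP g; rewrite mulrDl -!mulrA.
by congr (_ * _ + _); rewrite [LHS](corner_idr ff gP) (corner_idl ff gP).
Qed.

Lemma corner_cover_projective : projective (F cover).
Proof.
pose b : {linear D -> F cover} :=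
  dcase (fun phi => linear_map_of (scale_linear (cover_gen phi))).
apply: (@projective_retract _ _ D (linear_map_of coords_linear) b); last first.
  exact/projective_dsum/projective_regular.
apply: corner_cover_ind => [|x y bx by_|phi g]; first by rewrite !linear0.
  by rewrite !linearD bx by_.
rewrite !linearZ; congr (_ *: _).
have -> : linear_map_of coords_linear (cover_gen phi) = dinj phi (1 : ((corner ff)^c)^o).
  apply: dsum_eq => chi; rewrite linear_map_ofE dproj_inj linear_map_ofE /=.
  apply: val_inj; rewrite /coords_fun /corner_of /= linear_map_ofE /=.
  rewrite -(linear_map_ofE (dproj_linear _)) -/(dproj chi) dproj_inj.
  by case: (chi == phi) => /=; rewrite ?mul0r.
by rewrite dcase_inj linear_map_ofE scale1r.
Qed.

(** If K is the kernel of the evaluation cover -> M, which need not be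
    surjective, then 0 -> Hom(fR, K) -> Hom(fR, cover) -> Hom(fR, M) -> 0 is
    exact. *)
Lemma corner_cover_ses K (j : {linear K -> cover}) :
  (forall x, j x = 0 -> x = 0) ->
  (forall y, cover_ev y = 0 <-> exists x, j x = y) ->
  ses (corner_map j) (corner_map cover_ev).
Proof.
move=> jinj jex; split.
- move=> phi phi0; apply: modHom_ext => x; apply: jinj.
  by rewrite -corner_mapE phi0.
- move=> phi; exists (cover_gen phi); apply: modHom_ext => x.
  by rewrite corner_mapE to_homE cover_evE.
- move=> phi; apply: modHom_ext => x; rewrite !corner_mapE; apply/jex.
  by eexists.
- move=> psi psi0; have [x|phi phiE] := factor_inj (h := hom_linear psi) jinj.
    by apply/jex; rewrite hom_linearE -corner_mapE psi0.
  exists (to_hom phi); apply: modHom_ext => x.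
  by rewrite corner_mapE to_homE phiE hom_linearE.
Qed.

(** A retraction of Hom(fR, j) over the corner ring is induced by a map of
    R-modules cover -> K. *)
Lemma corner_retraction K (j : {linear K -> cover})
    (r : {linear F cover -> F K}) : (forall phi, r (corner_map j phi) = phi) ->
  exists rho : {linear cover -> K},
    (forall phi x, exists psi : F K, rho (dinj phi x) = (psi : modHom _ _) x) /\
    (forall (phi : F K) x, rho (j ((phi : modHom _ _) x)) = (phi : modHom _ _) x).
Proof.
move=> rj; pose rho : {linear cover -> K} :=
  dcase (fun phi => hom_linear (r (cover_gen phi))).
have rhoE : forall psi : F cover, r psi = corner_map rho psi.
  apply: corner_cover_ind => [|x y ex ey|phi g]; first by rewrite !linear0.
    by rewrite !linearD ex ey.
  rewrite !linearZ; congr (_ *: _); apply: modHom_ext => x.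
  by rewrite corner_mapE to_homE dcase_inj hom_linearE.
exists rho; split=> [phi x|phi x].
  by exists (r (cover_gen phi)); rewrite dcase_inj hom_linearE.
by rewrite -{2}[phi]rj rhoE !corner_mapE.
Qed.

End Cover.

(** * Traces of modules of finite projective dimension over the corner *)

Section Induction.
Variables (S : rmodType R) (n : nat).
(* Here n + 1 is the degree of the last nonzero self-extension of S. *)
Hypothesis S_annihilated : annihilated S.
Hypothesis ext_annihilated : forall Q m, annihilated Q -> (n < m)%N ->
  ext_vanish S m.+1 Q.
Hypothesis annihilated_eq0 : forall Q, annihilated Q -> ext_vanish S n.+1 Q ->
  forall x : Q, x = 0.

Lemma cover_ext_vanish M m : ext_vanish S m (cover M).
Proof.
case: m => [|m]; last exact/ext_vanish_projective/cover_projective.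
move=> h; apply: (dsum_ext (b := \0)) => i x.
exact: (annihilated_hom0 (h \o dinj i) x S_annihilated).
Qed.

(** Ext^m(MfR, S) = 0 for all m. The trace MfR is any module M' through which
    the evaluation cover -> M factors as a surjection and an injection. *)
Definition trace_ext_vanish M : Prop :=
  forall M' (p : {linear cover M -> M'}) (i : {linear M' -> M}),
    (forall z, exists x, p x = z) -> (forall x, i x = 0 -> x = 0) ->
    (forall d, i (p d) = cover_ev M d) -> forall m, ext_vanish S m M'.

Lemma trace_coker_annihilated M M' Q (p : {linear cover M -> M'})
    (i : {linear M' -> M}) (q : {linear M -> Q}) :
  (forall d, i (p d) = cover_ev M d) -> ses i q -> annihilated Q.
Proof.
move=> ipE [iinj qs qi qex] x.
have [h hE] := eR_projective (eR_act x) qs.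
have hg : h eR_gen = i (p (dinj (to_hom h : modHom _ _) eR_gen)).
  by rewrite ipE [RHS](cover_evE (to_hom h)).
by have := hE eR_gen; rewrite hg qi eR_actE.
Qed.

(** If Ext^m(MfR, S) = 0 for all m and Ext^(n+1)(M, S) = 0, then
    Ext^(n+1)(M / MfR, S) = 0, so M / MfR = 0 and M = MfR. *)
Lemma trace_ext_vanish_all M : trace_ext_vanish M -> ext_vanish S n.+1 M ->
  forall m, ext_vanish S m M.
Proof.
move=> good evM m; have [M' [p [i [ps iinj ipE]]]] := image_factor (cover_ev M).
have [Q [q siq]] := cokernel_ses iinj; have ev' := good _ _ _ ps iinj ipE.
have Qann := trace_coker_annihilated ipE siq.
have Q0 := annihilated_eq0 Qann (ext_vanish_right siq (ev' n) evM).
have [x|r rE] := factor_inj (h := idfun) iinj; last exact: ext_vanish_retract rE (ev' m).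
by apply: (ses_exact siq); apply: Q0.
Qed.

(** The vanishing of Ext^m(M, S) for m > n passes from M to MfR, as
    Ext^(m+1)(M / MfR, S) = 0, and then to the kernel K of cover -> MfR. *)
Lemma trace_ext_vanish_step M K M' (p : {linear cover M -> M'}) (i : {linear M' -> M})
    (j : {linear K -> cover M}) :
  ses j p -> (forall x, i x = 0 -> x = 0) -> (forall d, i (p d) = cover_ev M d) ->
  (forall m, (n <= m)%N -> ext_vanish S m.+1 M) ->
  (forall m, (n <= m)%N -> ext_vanish S m.+1 K).
Proof.
move=> sjp iinj ipE evM m nm; have [Q [q siq]] := cokernel_ses iinj.
have Qann := trace_coker_annihilated ipE siq.
apply: (ext_vanish_kernel (@cover_projective M) sjp).
apply: (ext_vanish_left siq); first exact/evM/leqW.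
by apply: ext_annihilated => //; rewrite ltnS leqW.
Qed.

(** Induction on the projective dimension of Hom(fR, M). Let K be
    the kernel of cover -> MfR. If Hom(fR, M) is projective, then Hom(fR, K) is a
    direct summand of Hom(fR, cover), so KfR is a direct summand of the cover;
    otherwise Hom(fR, K) has smaller projective dimension. In both cases Ext^m(KfR, S) = 0 for all m, hence K = KfR and Ext^m(MfR, S) = 0. *)
Lemma trace_ext_vanishP M (p : nat) :
  (forall N : lmodType (corner ff)^c, ext_vanish N p.+1 (F M)) ->
  (forall m, (n <= m)%N -> ext_vanish S m.+1 M) -> trace_ext_vanish M.
Proof.
elim: p M => [|d IH] M pd evM M' p i ps iinj ipE;
  have [K [j sjp]] := kernel_ses ps;
  have evK := trace_ext_vanish_step sjp iinj ipE evM;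
  have [jinj _ pj pex] := sjp.
all: have jex y : cover_ev M y = 0 <-> exists x, j x = y.
1,3: by rewrite -ipE; split=> [/iinj/pex//|[x <-]]; rewrite pj linear0.
all: have sF := corner_cover_ses jinj jex.
all: suff good : trace_ext_vanish K.
1,3: have evK' := trace_ext_vanish_all good (evK _ (leqnn n)).
1,2: case=> [h z|m]; last by exact: ext_vanish_right sjp (evK' m) (cover_ext_vanish _ _).
1,2: by have [x <-] := ps z; exact: (cover_ext_vanish M 0 (h \o p)).
(* Projective dimension 0: the sequence of modules over the corner splits. *)
- have [r rE] := pd (F K) _ _ _ _ sF idfun.
  have [rho [rhoi rhoE]] := corner_retraction rE.
  move=> K' pK iK pKs iKinj iKE m.
  have [|b bE] := factor_inj (h := rho) iKinj.
    apply: dsum_ind => [|x y [x' xE] [y' yE]|phi x].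
    - by exists 0; rewrite !linear0.
    - by exists (x' + y'); rewrite !linearD xE yE.
    have [psi ->] := rhoi phi x.
    by exists (pK (dinj (psi : modHom _ _) x)); rewrite iKE cover_evE.
  apply: (@ext_vanish_retract _ _ m _ _ (j \o iK) b) (cover_ext_vanish M m) => k.
  have [x <-] := pKs k; apply/eqP; rewrite -subr_eq0; apply/eqP/iKinj/subl_eq0.
  rewrite bE /= iKE.
  apply: (dsum_ext (a := rho \o j \o cover_ev K)) => psi w /=.
  by rewrite !cover_evE rhoE.
- apply: IH => [N|]; last exact: evK.
  exact: ext_vanish_kernel (@corner_cover_projective M) sF (pd N).
Qed.

End Induction.
End Corner.

(** * Positively graded algebras *)

Section Grading.
Variables (k : fieldType) (A : algType k) (G : positive_grading A).

(** [deg_ge d a]: a is a sum of homogeneous elements of degree at least d. *)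
Definition deg_ge (d : nat) (a : A) : Prop :=
  exists (n : nat) (u : nat -> A),
    (forall i, u i \in G (d + i)%N) /\ a = \sum_(i < n) u i.

Lemma deg_geD d a b : deg_ge d a -> deg_ge d b -> deg_ge d (a + b).
Proof.
move=> [n [u [uG ->]]] [m [v [vG ->]]].
pose cut p (w : nat -> A) i := if (i < p)%N then w i else 0.
have cutG p w : (forall i, w i \in G (d + i)%N) -> forall i, cut p w i \in G (d + i)%N.
  by move=> wG i; rewrite /cut; case: ifP => // _; exact: rpred0.
have cutE p q (w : nat -> A) : (p <= q)%N -> \sum_(i < p) w i = \sum_(i < q) cut p w i.
  by move=> pq; rewrite (big_ord_widen q w pq) big_mkcond.
exists (maxn n m), (fun i => cut n u i + cut m v i); split=> [i|].
  by apply: rpredD; apply: cutG.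
by rewrite big_split /= -!cutE ?leq_maxl ?leq_maxr.
Qed.

Lemma deg_ge0 d : deg_ge d 0.
Proof. by exists 0%N, (fun=> 0); split=> [i|]; rewrite ?rpred0 ?big_ord0. Qed.

Lemma deg_ge_sum d (I : Type) (s : seq I) (u : I -> A) :
  (forall i, deg_ge d (u i)) -> deg_ge d (\sum_(i <- s) u i).
Proof.
by move=> uG; apply: (big_ind (deg_ge d)) => //; [exact: deg_ge0|exact: deg_geD].
Qed.

Lemma deg_ge_homog d i a : (d <= i)%N -> a \in G i -> deg_ge d a.
Proof.
move=> /subnKC <-; move: (i - d)%N => {}i aG.
exists i.+1, (fun j => if j == i then a else 0); split=> [j|].
  by case: eqP => [->|_] //; exact: rpred0.
rewrite (bigD1 ord_max) //= eqxx big1 ?addr0 // => j.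
by rewrite -val_eqE /= => /negbTE ->.
Qed.

Lemma gr_mem_mul i j a b : a \in G i -> b \in G j -> a * b \in G (i + j)%N.
Proof.
by move=> aG bG; apply/gr_mul; exists 1%N, (fun=> a), (fun=> b); rewrite big_ord1.
Qed.

Lemma deg_geM d d' a b : deg_ge d a -> deg_ge d' b -> deg_ge (d + d') (a * b).
Proof.
move=> [n [u [uG ->]]] [m [v [vG ->]]]; rewrite mulr_suml.
apply: deg_ge_sum => i; rewrite mulr_sumr; apply: deg_ge_sum => j.
apply: (@deg_ge_homog _ (d + i + (d' + j))); last exact: gr_mem_mul.
by rewrite addnACA leq_addr.
Qed.

Lemma deg_ge_all a : deg_ge 0 a.
Proof. exact: gr_span. Qed.

Lemma deg_geMr d a b : deg_ge d a -> deg_ge d (a * b).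
Proof. by move=> da; rewrite -[d]addn0; apply: deg_geM => //; apply: deg_ge_all. Qed.

Lemma deg_geMl d a b : deg_ge d b -> deg_ge d (a * b).
Proof. by move=> db; rewrite -[d]add0n; apply: deg_geM => //; apply: deg_ge_all. Qed.

Lemma deg_ge_eq0 i a : a \in G i -> deg_ge i.+1 a -> a = 0.
Proof.
move=> aG [n [u [uG aE]]].
pose v j := if j == i then a else if (j < i)%N then 0 else - u (j - i.+1)%N.
have vG j : v j \in G j.
  rewrite /v; case: eqP => [->//|ji]; case: ltnP => ij; first exact: rpred0.
  have {}ij : (i < j)%N by rewrite ltn_neqAle ij andbT; apply/eqP => /esym.
  by rewrite -scaleN1r rpredZ //; have := uG (j - i.+1)%N; rewrite subnKC.
have v0 : \sum_(j < i.+1 + n) v j = 0.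
  rewrite big_split_ord /= big_ord_recr /= {2}/v eqxx big1 => [|j _]; last first.
    by rewrite /v ltn_eqF ?ltn_ord.
  rewrite add0r {1}aE -big_split big1 //= => j _.
  rewrite /v gtn_eqF ?leq_addr // ltnNge (leq_trans (leqnSn i)) ?leq_addr //=.
  by rewrite addKn subrr.
by have := gr_direct vG v0 (leq_addr n i.+1 : (i < i.+1 + n)%N); rewrite /v eqxx.
Qed.

Lemma deg_split a : exists a0 r, [/\ a0 \in G 0%N, in_rad G r & a = a0 + r].
Proof.
have [[|n] [u [uG ->]]] := gr_span G a.
  by exists 0, 0; rewrite rpred0 big_ord0 addr0; split=> //; apply: in_rad0.
exists (u 0%N), (\sum_(i < n) u i.+1); rewrite big_ord_recl; split=> //.
by exists n, (fun i => u i.+1).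
Qed.

Variables (e : A) (e_prim : primitive_idempotent e) (e_deg0 : e \in G 0%N).
Let ee : e * e = e := primitive_idem e_prim.

(** In the product A_0 of copies of k, the idempotent e is the unit of one of
    the factors, so e A_0 = A_0 e = k e. *)
Lemma primitive_deg0 a : a \in G 0%N ->
  exists c : k, e * a = c *: e /\ a * e = c *: e.
Proof.
have [n [phi [[phi1 phiM] phiI phiE]]] := gr_zero G.
move=> /phiE[x <-]; have /phiE[c cE] := e_deg0.
have cc : c * c = c by apply: phiI; rewrite phiM cE.
have cci i : c i = 0 \/ c i = 1.
  have := congr1 (fun g : {ffun 'I_n -> k^o} => g i) cc; rewrite ffunE => cci.
  have [->|ci] := eqVneq (c i) 0; [by left|right].
  by apply: (mulfI (ci : (c i : k) != 0)); rewrite mulr1.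
have [i ci] : exists i, c i = 1.
  apply: contrapT => no; apply: (primitive_neq0 e_prim).
  rewrite -cE (_ : c = 0) ?linear0 //; apply/ffunP => i; rewrite [RHS]ffunE.
  by have [//|ci] := cci i; case: no; exists i.
pose d : {ffun 'I_n -> k^o} := [ffun j => if j == i then 1 else 0].
have dd : d * d = d.
  by apply/ffunP => j; rewrite !ffunE; case: eqP; rewrite ?mulr1 ?mulr0.
have dc : d * c = d.
  by apply/ffunP => j; rewrite !ffunE; case: eqP => [->|]; rewrite ?ci ?mulr1 ?mul0r.
have cd : c * d = d.
  by apply/ffunP => j; rewrite !ffunE; case: eqP => [->|]; rewrite ?ci ?mulr1 ?mulr0.
(* e = phi d + phi (c - d) is a sum of orthogonal idempotents. *)
have [d0|cd0] : phi d = 0 \/ phi (c - d) = 0.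
  apply: (primitive_indec e_prim); rewrite -?phiM.
  - by rewrite dd.
  - by rewrite mulrBl !mulrBr cc dd dc cd subrr subr0.
  - by rewrite mulrBr dc dd subrr linear0.
  - by rewrite mulrBl cd dd subrr linear0.
  - by rewrite -linearD addrC subrK.
- have : d = 0 by apply: phiI; rewrite linear0.
  move=> /(congr1 (fun g : {ffun 'I_n -> k^o} => g i)); rewrite !ffunE eqxx.
  by move/eqP; rewrite oner_eq0.
have {cd0 cd dc} cE' : c = d.
  by apply/eqP; rewrite -subr_eq0; apply/eqP/phiI; rewrite linear0.
exists (x i); rewrite -cE -!phiM -linearZ cE'; split; congr (phi _);
  apply/ffunP => j; rewrite !ffunE; case: eqP => [->|_].
- by rewrite mul1r [RHS]mulr1.
- by rewrite mul0r scaler0.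
- by rewrite mulr1 [RHS]mulr1.
- by rewrite mulr0 scaler0.
Qed.

Let f := 1 - e.

Lemma deg0_off_diagonal a : a \in G 0%N -> e * a * f = 0.
Proof.
by move=> /primitive_deg0[c [-> _]]; rewrite -scalerAl /f mulrBr mulr1 ee subrr scaler0.
Qed.

(** * The simple module S and its direct sums *)

Local Notation S := (topS G e).
Implicit Types Q E : rmodType A.

(** f and rad A act on Q as zero. By simple_like_retract these modules are the
    direct summands of direct sums of copies of S. *)
Definition simple_like Q : Prop := annihilated f Q /\
  forall (r : A) (x : Q), in_rad G r -> (r : A^c) *: x = 0.

Lemma annihilatedE Q (x : Q) : annihilated f Q -> (e : A^c) *: x = x.
Proof.
move=> Qf; rewrite -[LHS]addr0 -(Qf x) -scalerDl.
rewrite (_ : (e : A^c) + f = 1) ?scale1r //.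
exact: (subrKC e 1).
Qed.

Lemma scale_conv Q (a b : A) (x : Q) :
  (a : A^c) *: ((b : A^c) *: x) = ((b * a : A) : A^c) *: x.
Proof. by rewrite scalerA. Qed.

Lemma scalar_conv_comm (c : k) (b : A^c) :
  (c%:A : A^c) * b = b * (c%:A : A^c).
Proof.
have E : (c%:A : A) * (b : A) = (b : A) * c%:A.
  by rewrite -scalerAl -scalerAr mul1r mulr1.
exact: (esym E).
Qed.

(** A acts on all these modules through one and the same map A -> k. *)
Lemma simple_like_scalar (a : A) : exists c : k, forall Q (x : Q),
  simple_like Q -> (a : A^c) *: x = (c%:A : A^c) *: x.
Proof.
have [a0 [r [a0G rG ->]]] := deg_split a; have [c [cE _]] := primitive_deg0 a0G.
exists c => Q x [Qf Qr].
rewrite -[LHS]/(((a0 : A^c) + (r : A^c)) *: x) scalerDl [X in _ + X]Qr // addr0.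
rewrite -{1}(annihilatedE x Qf) scale_conv cE.
by rewrite -{2}(annihilatedE x Qf) scale_conv -scalerAr mulr1.
Qed.

(** The projection eA -> S. *)
Definition top_pi : {linear eR e -> S} := @quotmod_pi _ _ (eRad_pred G (e := e)).

Lemma top_pi_surj z : exists x, top_pi x = z.
Proof. by exists (quotmod_repr z); apply: quotmod_reprK. Qed.

Lemma top_pi_eq0 x :
  top_pi x = 0 <-> exists r : A, in_rad G r /\ submod_val x = e * r :> A.
Proof.
rewrite -(linear0 top_pi); split=> [/quotmod_piP|xr].
  by rewrite subr0 => /asboolP.
by apply/quotmod_piP; rewrite subr0; apply/asboolP.
Qed.

(** The image of e, a generator of S. *)
Definition top_gen : S := top_pi (eR_gen e).

Lemma top_genP z : exists a : A, z = (a : A^c) *: top_gen.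
Proof.
have [x <-] := top_pi_surj z; exists (submod_val x : A).
by rewrite -linearZ -eR_genE.
Qed.

Lemma top_ext Q (g h : {linear S -> Q}) : g top_gen = h top_gen -> g =1 h.
Proof. by move=> gh z; have [a ->] := top_genP z; rewrite !linearZ gh. Qed.

Lemma top_gen_neq0 : top_gen <> 0.
Proof.
move=> /top_pi_eq0[r [rG er]]; apply: (primitive_neq0 e_prim).
apply: (deg_ge_eq0 e_deg0); rewrite [e]er.
exact: (@deg_geMl 1 e r rG).
Qed.

Lemma eR_scaleE (r : A) (x : eR e) :
  submod_val ((r : A^c) *: x) = (submod_val x : A) * r :> A.
Proof. exact: erefl. Qed.

Lemma top_simple_like : simple_like S.
Proof.
split=> [z|r z rG]; have [x <-] := top_pi_surj z; rewrite -linearZ;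
  apply/top_pi_eq0; have /asboolP[a xa] := valP x.
  have [a0 [r [a0G rG aE]]] := deg_split a; exists (r * f); split.
    exact: in_radMr.
  rewrite eR_scaleE xa.
  by rewrite aE (mulrDr e a0) mulrDl deg0_off_diagonal // add0r mulrA.
exists (a * r); split; first exact: (@deg_geMl 1 a r rG).
by rewrite eR_scaleE xa mulrA.
Qed.

Lemma simple_like_map Q (x : Q) : simple_like Q ->
  exists h : {linear S -> Q}, h top_gen = x.
Proof.
move=> [Qf Qr].
have [y /top_pi_eq0[r [rG yE]]|h hE] := factor_surj (h := eR_act e x) top_pi_surj.
  by rewrite eR_actE yE -scale_conv Qr.
by exists h; rewrite hE eR_actE /= annihilatedE.
Qed.

Lemma simple_like_dsum I Q : simple_like Q -> simple_like (dsum I Q).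
Proof.
move=> [Qf Qr]; split=> [d|r d rG]; apply: dsum_eq => i.
  by rewrite linearZ linear0; apply: Qf.
by rewrite linearZ linear0; apply: Qr.
Qed.

(** Semisimplicity: a submodule maximal among those that meet the kernel of the
    surjection trivially is a complement of it. *)
Lemma simple_like_split E Q (s : {linear E -> Q}) :
  simple_like E -> simple_like Q -> (forall y, exists x, s x = y) ->
  exists t : {linear Q -> E}, forall y, s (t y) = y.
Proof.
move=> slE slQ ss.
pose closed (W : set E) := forall (a : A^c) x y, W x -> W y -> W (a *: x + y).
pose P (W : set E) := closed W /\ forall x, W x -> s x = 0 -> x = 0.
have [W [[Wc Wk] Wmax]] : exists W, P W /\ forall B, (W `<` B)%classic -> ~ P B.
  apply: Zorn_bigcup => F FP Ftot; split=> [a x y [X FX Xx] [Y FY Yy]|x [X FX Xx]].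
    have [XY|YX] := Ftot _ _ FX FY.
      by exists Y => //; have [Yc _] := FP _ FY; apply: Yc => //; apply: XY.
    by exists X => //; have [Xc _] := FP _ FX; apply: Xc => //; apply: YX.
  by have [_ Xk] := FP _ FX; apply: Xk.
(* Zorn's lemma allows W to be empty, but {0} is larger. *)
have W0 : W 0.
  apply: contrapT => W0; have We x : ~ W x.
    by move=> Wx; apply: W0; have := Wc (-1) _ _ Wx Wx; rewrite scaleN1r addNr.
  apply: (Wmax (fun x => x = 0)).
    by split=> [x /We//|/(_ 0 erefl)].
  by split=> // a x y -> ->; rewrite scaler0 addr0.
have Ws q : exists2 x, W x & s x = q.
  apply: contrapT => no; have [e' e'E] := ss q.
  apply: (Wmax (fun x => exists w (a : A^c), W w /\ x = w + a *: e')).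
    split=> [x Wx|/(_ e') We'].
      by exists x, 0; rewrite scale0r addr0.
    apply: no; exists e' => //; apply: We'.
    by exists 0, 1; rewrite scale1r add0r.
  split=> [a _ _ [w [b [Ww ->]]] [w' [b' [Ww' ->]]]|_ [w [a [Ww ->]]]].
    exists (a *: w + w'), (a * b + b'); split; first exact: Wc.
    by rewrite scalerDr scalerA scalerDl addrACA.
  have [c cE] := simple_like_scalar a.
  rewrite (cE E) // linearD linearZ /= e'E => wc.
  have [c0|c0] := eqVneq c 0.
    move: wc; rewrite c0 !scale0r !addr0; exact: Wk.
  case: no; exists (((- c^-1)%:A : A^c) *: w).
    by rewrite -[_ *: _]addr0; apply: Wc.
  have sw : s w = - ((c%:A : A^c) *: q) by apply/eqP; rewrite -addr_eq0 wc.
  rewrite linearZ /= sw scalerN scale_conv -scalerAl mul1r scalerA mulrN divff //.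
  by rewrite scaleN1r scaleNr opprK scale1r.
have [N [i [iinj iE]]] := exists_submodule (conj W0 Wc).
have Wi n : W (i n) by apply/iE; exists n.
have [n sin|q|t tE] := @factor_inj _ _ _ _ (s \o i) idfun.
- by apply: iinj; apply: Wk.
- by have [x /iE[n <-] <-] := Ws q; exists n.
by exists (i \o t).
Qed.

(** Q is a retract of a direct sum of copies of S. *)
Lemma simple_like_retract Q : simple_like Q ->
  exists (a : {linear Q -> dsum Q S}) (b : {linear dsum Q S -> Q}),
    forall x, b (a x) = x.
Proof.
move=> slQ; have /choice[h hE] x := simple_like_map x slQ.
have [|y|a aE] := @simple_like_split (dsum Q S) Q (dcase h) _ slQ.
- exact/simple_like_dsum/top_simple_like.
- by exists (dinj y top_gen); rewrite dcase_inj.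
by exists a, (dcase h).
Qed.

Lemma simple_like_functional Q (x : Q) : simple_like Q -> x <> 0 ->
  exists h : {linear Q -> S}, h x <> 0.
Proof.
move=> slQ x0; have [a [b ab]] := simple_like_retract slQ.
apply: contrapT => no; apply: x0; rewrite -(ab x) (_ : a x = 0) ?linear0 //.
apply: dsum_eq => i; rewrite linear0; apply: contrapT => ai.
by apply: no; exists (dproj i \o a).
Qed.

Lemma top_retract Q (x : Q) : simple_like Q -> x <> 0 ->
  exists (a : {linear S -> Q}) (b : {linear Q -> S}), forall z, b (a z) = z.
Proof.
move=> slQ x0; have [h hx] := simple_like_functional slQ x0.
have [a aE] := simple_like_map x slQ.
have [r rE] := top_genP (h x); have [c cE] := simple_like_scalar r.
have slS := top_simple_like.
have c0 : c != 0.
  by apply/eqP => c0; apply: hx; rewrite rE (cE S) // c0 !scale0r.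
have ls : linear (fun z : Q => ((c^-1)%:A : A^c) *: h z).
  move=> b y z; rewrite linearP scalerDr !scalerA; congr (_ *: _ + _).
  exact: scalar_conv_comm.
exists a, (linear_map_of ls).
apply: (top_ext (g := linear_map_of ls \o a) (h := idfun)) => /=.
rewrite linear_map_ofE aE rE (cE S) // scale_conv.
by rewrite -scalerAl mul1r scalerA divff // scale1r scale1r.
Qed.

Lemma simple_like_ext_vanish Q m : simple_like Q ->
  ext_vanish S m.+1 S -> ext_vanish S m.+1 Q.
Proof.
move=> slQ ev; have [a [b ab]] := simple_like_retract slQ.
exact: ext_vanish_retract ab (ext_vanish_dsum Q ev).
Qed.

(** A nonzero y in e A_1 e would give a nonzero map from e rad A to S, which
    does not extend to eA. *)
Lemma ext1_no_loop x : ext_vanish S 1 S -> x \in G 1%N -> e * x * e = 0.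
Proof.
move=> ev xG; apply: contrapT => y0; set y := e * x * e in y0.
have yG : y \in G 1%N by apply: (@gr_mem_mul 1 0) => //; apply: (@gr_mem_mul 0 1).
have [U [j sj]] := kernel_ses top_pi_surj; have [jinj _ pj pex] := sj.
have rad_j u : in_rad G (submod_val (j u)).
  have /top_pi_eq0[r [rG ->]] := pj u; exact: (@deg_geMl 1 e r rG).
(* U is e rad A, and u |-> u e identifies U / W with e A_1 e, up to terms of
   degree at least 2. *)
pose W (u : U) := deg_ge 2 ((submod_val (j u) : A) * e).
have Wc : W 0 /\ forall (a : A^c) u v, W u -> W v -> W (a *: u + v).
  split=> [|a u v Wu Wv]; first by rewrite /W linear0 mul0r; apply: deg_ge0.
  rewrite /W linearP.
  have -> : submod_val (a *: j u + j v) =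
    (submod_val (j u) : A) * (a : A) + submod_val (j v) :> A by exact: erefl.
  rewrite mulrDl; apply: deg_geD => //.
  have [a0 [r [a0G rG ->]]] := deg_split a.
  rewrite mulrDr mulrDl; apply: deg_geD; last first.
    by apply: deg_geMr; apply: (@deg_geM 1 1); [exact: rad_j|exact: rG].
  have [c [_ cE]] := primitive_deg0 a0G.
  rewrite -mulrA cE -[c *: e]mulr1 -scalerAl scalerAr mulrA.
  exact: deg_geMr.
have [T [g [gs gE]]] := exists_quotient Wc.
have slT : simple_like T.
  split=> [t|r t rG]; have [u <-] := gs t; rewrite -linearZ; apply/gE;
    rewrite /W linearZ_LR eR_scaleE.
    rewrite -mulrA /f mulrBl mul1r ee subrr mulr0; exact: deg_ge0.
  apply: deg_geMr; apply: (@deg_geM 1 1); [exact: rad_j|exact: rG].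
have yeR : (y : (A^c)^o) \in eR_pred e by apply/asboolP; exists (x * e); rewrite /y mulrA.
pose yR : eR e := @Submod _ _ (eR_pred e : submodClosed _) _ yeR.
have yrad : in_rad G y by apply: (in_rad_homog (i := 0)).
have [|u uE] := pex yR.
  apply/top_pi_eq0; exists y; split=> //.
  by rewrite -[LHS]/y /y !mulrA ee.
have gu : g u <> 0.
  move=> /gE; rewrite /W uE -[submod_val yR]/y /y -mulrA ee -/y => /(deg_ge_eq0 yG).
  exact: y0.
have [h hu] := simple_like_functional slT gu.
have [h' h'E] := ev _ _ _ _ sj (h \o g).
apply: hu; rewrite -[LHS]h'E uE [yR](eR_genE ee) linearZ /=.
exact: (top_simple_like.2 y).
Qed.

Lemma scale_conv_sum Q n (u : 'I_n -> A) (x : Q) :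
  ((\sum_i u i : A) : A^c) *: x = \sum_i ((u i : A^c) *: x).
Proof. exact: (scaler_suml x _ _ (u : 'I_n -> A^c)). Qed.

(** As e A_1 e = 0 and rad A is generated by A_1, Qf = 0 implies Q rad A = 0. *)
Lemma annihilated_simple_like Q :
  ext_vanish S 1 S -> annihilated f Q -> simple_like Q.
Proof.
move=> ev Qf; split=> // r x [n [u [uG ->]]].
rewrite scale_conv_sum big1 // => i _.
have /(gr_mul _ 1 i)[m [a [b [aG _ ->]]]] := uG i.
rewrite scale_conv_sum big1 // => l _.
rewrite -scale_conv -[x](annihilatedE _ Qf) [X in _ *: X]scale_conv.
have -> : e * a l = e * a l * f.
  by rewrite /f mulrBr mulr1 (ext1_no_loop ev (aG l)) subr0.
by rewrite -[X in _ *: X]scale_conv Qf scaler0.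
Qed.

(** If Ext^m(S, S) = 0 for all m > n + 1, then Ext^(n+1)(S, S) = 0. Otherwise
    eA equals eAfA, but the latter has no nonzero map to S. *)
Lemma top_ext_vanish_step n : finite_pd (cornerHom (eR e) (idem_compl ee)) ->
  ext_vanish S 1 S -> (forall m, (n < m)%N -> ext_vanish S m.+1 S) ->
  ext_vanish S n.+1 S.
Proof.
move=> /finite_pd_ext_vanish[d pd] ev1 evS; apply: contrapT => evn.
have Sf : annihilated f S := top_simple_like.1.
have ev_ann Q m : annihilated f Q -> (n < m)%N -> ext_vanish S m.+1 Q.
  by move=> /(annihilated_simple_like ev1) slQ nm; apply/simple_like_ext_vanish/evS.
have ann0 Q : annihilated f Q -> ext_vanish S n.+1 Q -> forall x : Q, x = 0.
  move=> /(annihilated_simple_like ev1) slQ evQ x; apply: contrapT => x0; apply: evn.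
  by have [a [b ab]] := top_retract slQ x0; exact: ext_vanish_retract ab evQ.
have eRp m : ext_vanish S m.+1 (eR e).
  exact/ext_vanish_projective/eR_projective.
have good := trace_ext_vanishP Sf ev_ann ann0 (fun N => pd d N (leqnn d))
  (fun m _ => eRp m).
have := trace_ext_vanish_all ann0 good (eRp n) 0%N top_pi (eR_gen e).
exact: top_gen_neq0.
Qed.

End Grading.

Theorem theorem6p6 (k : closedFieldType) (A : algType k)
    (G : positive_grading A) (A_noetherian : noetherian_ring A)
    (e : A) (e_primitive : primitive_idempotent e) (e_deg0 : e \in G 0%N)
    (Ext1_S : Ext_eq0 1%N (topS G e) (topS G e))
    (pd_S : finite_pd (topS G e))
    (pd_FeA : finite_pd
       (cornerHom (eR e) (idem_compl (primitive_idem e_primitive))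
        : rmodType (corner (idem_compl (primitive_idem e_primitive))))) :
  forall i : nat, (0 < i)%N -> Ext_eq0 i (topS G e) (topS G e).
Proof.
have ev1 : ext_vanish (topS G e) 1 (topS G e).
  by have [P _] := pd_S; apply/(ext_vanish_resolution _ _ P)/Ext1_S.
have [d evd] := finite_pd_ext_vanish pd_S.
suff ev c n : (d <= n + c)%N -> ext_vanish (topS G e) n.+1 (topS G e).
  case=> // n _ P; apply/(ext_vanish_resolution _ _ P)/(ev d).
  exact: leq_addl.
elim: c n => [|c IH] n dn; first by apply: evd; rewrite -(addn0 n).
apply: (top_ext_vanish_step e_deg0 pd_FeA ev1) => m nm; apply: IH.
by rewrite (leq_trans dn) // addnS -addSn leq_add2r.
Qed.
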